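(* There are universal constants $n_0\in\mathbb N$ and $C>0$ with the following property. Let $n\ge n_0$ and let $A$ be an $n\times n$ random matrix with independent isotropic rows such that, for some $K>0$, each row $X$ of $A$ satisfies the following for $m=1$ and for $m=4$: for every $m$-dimensional linear subspace $F\subset\mathbb R^n$, the random vector $\mathrm{Proj}_F(X)$ has a distribution density (viewed as a function on $F$) bounded above by $K$. Then for every $t>0$, $$\mathbb P\big\{\|A^{-1}\|_{HS}\ge t n^{1/2}\big\}\le \frac{CK}{t}.$$
   Context: All matrices are real. A random vector $X$ in $\mathbb R^n$ is isotropic if $\mathbb E X=0$ and its covariance matrix is the identity. $\mathrm{Proj}_F$ is the orthogonal projection onto $F$; densities on $F$ are with respect to Lebesgue measure on $F$. $\|B\|_{HS}=\sqrt{\sum_{i,j}b_{ij}^2}$ is the Hilbert--Schmidt norm. Under the hypotheses $A$ is almost surely invertible, so the event is defined up to a null set. *)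

(* Defs.v *)
From HB Require Import structures.
From mathcomp Require Import all_boot all_order all_algebra.
From mathcomp Require Import all_classical all_reals all_analysis.

Set Implicit Arguments.
Unset Strict Implicit.
Unset Printing Implicit Defensive.

Import Order.TTheory GRing.Theory Num.Theory.
Import numFieldNormedType.Exports.
Local Open Scope classical_set_scope.
Local Open Scope ring_scope.

(* The sigma-algebra on matrices generated by the entries, i.e. the Borel
   sigma-algebra of R^(m * n). *)
Section matrix_measurable.
Context (R : realType) (m n : nat).

Definition mx_entry_sets : set (set 'M[R]_(m, n)) :=
  [set A | exists (i : 'I_m) (j : 'I_n) (B : set R),
     measurable B /\ A = (fun M : 'M[R]_(m, n) => M i j) @^-1` B].

Let mx_set0 : <<s mx_entry_sets >> set0.
Proof. exact: sigma_algebra0. Qed.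

Let mx_setC A : <<s mx_entry_sets >> A -> <<s mx_entry_sets >> (~` A).
Proof. exact: sigma_algebraC. Qed.

Let mx_bigcup (F : (set 'M[R]_(m, n))^nat) :
  (forall i, <<s mx_entry_sets >> (F i)) ->
  <<s mx_entry_sets >> (\bigcup_i F i).
Proof. exact: sigma_algebra_bigcup. Qed.

HB.instance Definition _ := @isMeasurable.Build default_measure_display
  'M[R]_(m, n) <<s mx_entry_sets >> mx_set0 mx_setC mx_bigcup.

Lemma measurable_mx_entry (i : 'I_m) (j : 'I_n) :
  measurable_fun setT (fun M : 'M[R]_(m, n) => M i j).
Proof.
move=> _ B mB; rewrite setTI; apply: sub_sigma_algebra.
by exists i, j, B.
Qed.

Lemma measurable_fun_mx d (T : measurableType d) (f : T -> 'M[R]_(m, n)) :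
  (forall i j, measurable_fun setT (fun w => f w i j)) -> measurable_fun setT f.
Proof.
move=> mf _ B; rewrite setTI.
apply: (@smallest_sub _ _ _ [set B | measurable (f @^-1` B)]) => /=.
  split=> /=.
  - by rewrite preimage_set0.
  - by move=> C mC; rewrite setTD preimage_setC; exact: measurableC.
  - by move=> F mF; rewrite preimage_bigcup; exact: bigcupT_measurable.
move=> _ [i [j [C [mC ->]]]] /=.
by have := mf i j measurableT C mC; rewrite setTI.
Qed.

End matrix_measurable.


Section lebesgue_space.
Context (R : realType).

(* Lebesgue measure on R^m, as an iterated product measure. *)
Fixpoint lebesgue_rV (m : nat) : set 'rV[R]_m -> \bar R :=
  match m with
  | 0 => \d_(0 : 'rV[R]_0)
  | m'.+1 => pushforward (@lebesgue_measure R \x @lebesgue_rV m')%E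
      (fun p => row_mx p.1%:M p.2 : 'rV[R]_(1 + m'))
  end.

Let cons_rV m (p : measurableTypeR R * 'rV[R]_m) : 'rV[R]_(1 + m) :=
  row_mx p.1%:M p.2.

Let cons_rV0 m (p : measurableTypeR R * 'rV[R]_m) :
  cons_rV p 0 (@lshift 1 m 0) = p.1.
Proof. by rewrite row_mxEl mxE eqxx mulr1n. Qed.

Let cons_rVS m (p : measurableTypeR R * 'rV[R]_m) i :
  cons_rV p 0 (@rshift 1 m i) = p.2 0 i.
Proof. by rewrite row_mxEr. Qed.

Let measurable_cons_rV m : measurable_fun setT (@cons_rV m).
Proof.
apply: measurable_fun_mx => i j; rewrite /cons_rV.
case: (split_ordP j) => k ->.
- apply: (eq_measurable_fun (fun p : measurableTypeR R * 'rV[R]_m => p.1)).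
    by move=> p _; rewrite row_mxEl mxE !ord1 eqxx mulr1n.
  exact: measurable_fst.
- apply: (eq_measurable_fun
    ((fun v : 'rV[R]_m => v i k) \o
     (snd : measurableTypeR R * 'rV[R]_m -> 'rV[R]_m))).
    by move=> p _ /=; rewrite row_mxEr.
  by apply: measurableT_comp; [exact: measurable_mx_entry|exact: measurable_snd].
Qed.

Let box (m : nat) (k : nat) : set 'rV[R]_m :=
  [set v | forall i, v 0 i \in `[- k%:R, k%:R]].

Let measurable_box m k : measurable (@box m k).
Proof.
rewrite (_ : box k = \big[setI/setT]_(i < m)
   ((fun v : 'rV[R]_m => v 0 i) @^-1` `[- k%:R, k%:R])); last first.
  apply/seteqP; split => v.
    by move=> bv; elim/big_ind : _ => // i _; exact: bv.
  by move=> + i; rewrite (bigD1 i) //= => -[].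
apply: bigsetI_measurable => i _.
rewrite -[X in measurable X]setTI.
by apply: measurable_mx_entry => //; exact: measurable_itv.
Qed.

Let boxT m : \bigcup_k box k = [set: 'rV[R]_m].
Proof.
apply/seteqP; split => // v _.
exists (Num.truncn (\sum_i `|v 0 i|)).+1 => // i.
rewrite in_itv /= -ler_norml.
apply: le_trans (ltW (truncnS_gt _)).
by rewrite (bigD1 i) //= lerDl sumr_ge0.
Qed.

Lemma lebesgue_rV_sigma_finite m :
  exists2 mu : {sigma_finite_measure set 'rV[R]_m -> \bar R},
    @lebesgue_rV m = mu & forall k, (mu (box k) < +oo)%E.
Proof.
elim: m => [|m [mu muE mufin]].
  exists [the {sigma_finite_measure set 'rV[R]_0 -> \bar R} of
           \d_(0 : 'rV[R]_0)] => //= k.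
  by rewrite diracE ltry.
pose nu := pushforward (@lebesgue_measure R \x mu)%E (@cons_rV m).
have [nu' nu'E] : exists nu' : {measure set 'rV[R]_m.+1 -> \bar R}, nu = nu'.
  pose M := measurable_cons_rV (m := m).
  by exists (measure_function_pushforward__canonical__measure_function_Measure
    (@lebesgue_measure R \x mu)%E M).
have fin k : (nu' (box k) < +oo)%E.
  rewrite -nu'E /nu /pushforward.
  rewrite (_ : _ @^-1` _ = `[- k%:R, k%:R] `*` @box m k); last first.
    apply/seteqP; split=> [[x v] b|[x v] [bx bv] i]; last first.
      case: (@split_ordP 1 m i) => j ->.
      + by rewrite ord1 cons_rV0.
      + by rewrite cons_rVS; exact: bv.
    split => [|i].
    - by have := b (@lshift 1 m 0); rewrite cons_rV0.
    - by have := b (@rshift 1 m i); rewrite cons_rVS.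
  rewrite product_measure1E//; last exact: measurable_box.
  apply: lte_mul_pinfty => //.
  by have /= -> := lebesgue_measure_itv `[- (k%:R : R), k%:R]; case: ifP.
have sf : sigma_finite setT nu'.
  exists (@box m.+1); first by rewrite boxT.
  by move=> k; split; [exact: measurable_box|exact: fin].
pose H1 := isSFinite.Build _ _ _ _ (sfinite_measure_sigma_finite sf).
pose H2 := isSigmaFinite.Build _ _ _ _ sf.
pose nu'' := HB.pack_for {sigma_finite_measure set 'rV[R]_m.+1 -> \bar R}
  (Measure.sort nu') H1 H2.
by exists nu'' => //=; rewrite muE -/nu nu'E.
Qed.

Let lebesgue_rV0 m : @lebesgue_rV m set0 = 0%E.
Proof. by have [mu -> _] := lebesgue_rV_sigma_finite m; exact: measure0. Qed.

Let lebesgue_rV_ge0 m (A : set 'rV[R]_m) : (0 <= lebesgue_rV A)%E.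
Proof. by have [mu -> _] := lebesgue_rV_sigma_finite m; exact: measure_ge0. Qed.

Let lebesgue_rV_semi_sigma_additive m : semi_sigma_additive (@lebesgue_rV m).
Proof.
by have [mu -> _] := lebesgue_rV_sigma_finite m;
  exact: measure_semi_sigma_additive.
Qed.

Let lebesgue_rV_sigma_finiteT m : sigma_finite setT (@lebesgue_rV m).
Proof.
by have [mu -> _] := lebesgue_rV_sigma_finite m; exact: sigma_finiteT.
Qed.

HB.instance Definition _ m := isMeasure.Build _ _ _ (@lebesgue_rV m)
  (@lebesgue_rV0 m) (@lebesgue_rV_ge0 m) (@lebesgue_rV_semi_sigma_additive m).

HB.instance Definition _ m := Measure_isSigmaFinite.Build _ _ _ (@lebesgue_rV m)
  (@lebesgue_rV_sigma_finiteT m).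

End lebesgue_space.

(* Vectors of R^n are row vectors, and a linear subspace F of R^n is the row
   space of a square matrix F, of dimension \rank F. *)
Section subspaces.
Context (R : realType) (n : nat).
Implicit Types F : 'M[R]_n.

Definition subspace_set F : set 'rV[R]_n := [set x | (x <= F)%MS].

(* x *m orthoproj F is the orthogonal projection of x onto F: the row kernel of
   F^T is the orthogonal complement of F. *)
Definition orthoproj F : 'M[R]_n := proj_mx F (kermx F^T).

Definition orthonormal_basis m F (U : 'M[R]_(m, n)) : Prop :=
  U *m U^T = 1%:M /\ (U :=: F)%MS.

(* Lebesgue measure on the row space of U, for orthonormal rows: the image of
   Lebesgue measure on R^m under the isometry x |-> x *m U. It depends only on
   the row space of U. *)
Definition lebesgue_subspace m (U : 'M[R]_(m, n)) : set 'rV[R]_n -> \bar R :=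
  pushforward (@lebesgue_rV R m) (fun x => x *m U).

End subspaces.

Section random_vectors.
Context d (T : measurableType d) (R : realType) (P : probability T R).

Definition isotropic n (X : T -> 'rV[R]_n) : Prop :=
  (forall i, 'E_P[fun w => X w 0%R i]%E = 0%E) /\
  (forall i j, covariance P (fun w => X w 0 i) (fun w => X w 0 j) =
               (i == j)%:R%:E).

Definition mutually_independent (I : finType) d' (S : measurableType d')
    (X : I -> T -> S) : Prop :=
  forall (J : {set I}) (B : I -> set S), (forall i, measurable (B i)) ->
    P (\bigcap_(i in [set` J]) X i @^-1` B i) =
    (\prod_(i in J) fine (P (X i @^-1` B i)))%:E.

Definition density_on n (F : 'M[R]_n) (mu : set 'rV[R]_n -> \bar R)
    (X : T -> 'rV[R]_n) (f : 'rV[R]_n -> R) : Prop :=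
  [/\ measurable_fun (subspace_set F) f,
      forall x, subspace_set F x -> 0 <= f x
    & forall B : set 'rV[R]_n, measurable B ->
        P (X @^-1` B) = (\int[mu]_(x in subspace_set F `&` B) (f x)%:E)%E].

Definition proj_density_bounded n (m : nat) (K : R) (X : T -> 'rV[R]_n) : Prop :=
  forall F : 'M[R]_n, \rank F = m ->
  forall U : 'M[R]_(m, n), orthonormal_basis F U ->
  exists f : 'rV[R]_n -> R,
    density_on F (lebesgue_subspace U) (fun w => X w *m orthoproj F) f /\
    (forall x, subspace_set F x -> f x <= K).

End random_vectors.

Definition hsnorm (R : realType) m n (B : 'M[R]_(m, n)) : R :=
  Num.sqrt (\sum_i \sum_j B i j ^+ 2).

(* The event ||A^-1||_HS >= s, with ||A^-1||_HS = +oo when A is singular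
   (invmx A is then a junk value). *)
Definition hsnorm_inv_ge (R : realType) n (s : R) : set 'M[R]_n :=
  [set A | A \in unitmx -> s <= hsnorm (invmx A)].

(* Main.v *)
Require Import Defs.
From mathcomp Require Import all_boot all_order all_algebra.
From mathcomp Require Import all_classical all_reals all_analysis.
From mathcomp Require Import measurable_realfun ring lra zify.
Set Implicit Arguments.
Unset Strict Implicit.
Unset Printing Implicit Defensive.
Import Order.TTheory GRing.Theory Num.Theory.
Local Open Scope classical_set_scope.
Local Open Scope ring_scope.

(* Let b_j be the columns of A^-1, so that |b_j|^-1 is the distance from row j
   to the span of the other rows and the squared Hilbert-Schmidt norm of A^-1 is
   the sum of the |b_j|^2. Put tau = t / 2. The one-dimensional density bound
   gives P(|b_j| >= u) <= 2 K / u, so by Markov's inequality it is unlikely that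
   half of the |b_j| exceed tau. Otherwise the mass of the sum comes from the
   columns with |b_j| >= q tau, q = 2^k, while more than half of the |b_i| are
   below tau. Let J consist of three such indices i, and let F be the orthogonal
   complement of the rows outside J and j. Projected to F, row j lies in a box
   with one side 2 / (q tau) and three sides of order s / q, where s is the sum
   of the lengths of the projections to F of the rows in J. The four- and
   one-dimensional density bounds and E s^2 <= 36 give probability
   O(K / (q^3 tau)) for this event, and Markov's inequality for the number of
   triples (j, J, k) with weights 4^k yields the theorem: the series
   sum_k 4^k / 8^k converges. *)

(** * Linear algebra of inverse columns and residual projections *)

Section linear_algebra.
Variable R : rcfType.

Definition dotr n (x y : 'rV[R]_n) : R := \sum_i x 0 i * y 0 i.

Lemma dotrE n (x y : 'rV[R]_n) : dotr x y = (x *m y^T) 0 0.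
Proof. by rewrite !mxE; apply: eq_bigr => i _; rewrite mxE. Qed.

Lemma dotr_ge0 n (x : 'rV[R]_n) : 0 <= dotr x x.
Proof. by apply: sumr_ge0 => i _; rewrite -expr2 sqr_ge0. Qed.

Lemma dotr_eq0 n (x : 'rV[R]_n) : dotr x x = 0 -> x = 0.
Proof.
move=> /eqP; rewrite psumr_eq0 => [/allP x0|i _]; last by rewrite -expr2 sqr_ge0.
apply/rowP => i; rewrite mxE; apply/eqP.
by have := x0 i (mem_index_enum _); rewrite /= -expr2 sqrf_eq0.
Qed.

(** When [bb] is nonzero, the nonnegative sum of the (bb a_i - ab b_i)^2 equals bb (aa bb - ab^2),
    and bb can be cancelled. *)
Lemma cauchy_schwarz (I : finType) (a b : I -> R) :
  (\sum_i a i * b i) ^+ 2 <= (\sum_i a i ^+ 2) * (\sum_i b i ^+ 2).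
Proof.
set ab := \sum_i _; set aa := \sum_i _; set bb := \sum_i _.
have bb_ge0 : 0 <= bb by apply: sumr_ge0 => i _; rewrite sqr_ge0.
have [bb0|bbN0] := eqVneq bb 0.
  have b0 i : b i = 0.
    move/eqP: bb0; rewrite psumr_eq0 => [/allP b0|k _]; last by rewrite sqr_ge0.
    by apply/eqP; have := b0 i (mem_index_enum _); rewrite /= sqrf_eq0.
  by rewrite bb0 mulr0 /ab big1 ?expr0n// => i _; rewrite b0 mulr0.
have : 0 <= \sum_i (bb * a i - ab * b i) ^+ 2.
  by apply: sumr_ge0 => i _; rewrite sqr_ge0.
have -> : \sum_i (bb * a i - ab * b i) ^+ 2 = bb * (aa * bb - ab ^+ 2).
  transitivity (\sum_i (bb ^+ 2 * a i ^+ 2 - 2 * bb * ab * (a i * b i) +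
      ab ^+ 2 * b i ^+ 2)).
    by apply: eq_bigr => i _; ring.
  rewrite big_split sumrB -!mulr_sumr -/aa -/bb -/ab /=.
  by ring.
by rewrite pmulr_rge0 ?subr_ge0// lt_def bbN0.
Qed.

Lemma unit_vector_orth m n (V : 'M[R]_(m, n)) : (\rank V < n)%N ->
  exists2 u : 'rV[R]_n, dotr u u = 1 & V *m u^T = 0.
Proof.
move=> rV.
have : kermx V^T != 0 by rewrite -mxrank_eq0 mxrank_ker mxrank_tr -lt0n subn_gt0.
case/rowV0Pn => v /sub_kermxP vV v0.
have vv_gt0 : 0 < dotr v v.
  by rewrite lt_def dotr_ge0 andbT; apply: contraNneq v0 => /dotr_eq0 ->.
exists ((Num.sqrt (dotr v v))^-1 *: v).
  set c := _^-1; have -> : dotr (c *: v) (c *: v) = c ^+ 2 * dotr v v.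
    by rewrite /dotr mulr_sumr; apply: eq_bigr => i _; rewrite !mxE; ring.
  by rewrite exprVn sqr_sqrtr ?ltW// mulVf ?gt_eqF.
by rewrite linearZ/= -scalemxAr -[V]trmxK -trmx_mul vV trmx0 scaler0.
Qed.

(** Vectors are added one at a time: the rows of [W] and of the current [U] span too little to fill
    the space, so [unit_vector_orth] supplies the next one. New vectors go on top, which keeps [u]
    as the last row. *)
Lemma orthonormal_completion p n k (W : 'M[R]_(p, n)) (u : 'rV[R]_n) :
  dotr u u = 1 -> W *m u^T = 0 -> (\rank W + k < n)%N ->
  exists U : 'M[R]_(k.+1, n),
    [/\ U *m U^T = 1%:M, W *m U^T = 0 & row ord_max U = u].
Proof.
move=> uu Wu; elim: k => [|k IH] rk.
  exists u; split => //; first by apply/matrixP => i j; rewrite !ord1 -dotrE uu mxE.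
  by apply/rowP => i; rewrite mxE ord1.
have [|U [UU WU Umax]] := IH; first by rewrite (leq_trans _ rk)// ltnS addnS.
have [|v vv Cv] := @unit_vector_orth _ _ (col_mx W U).
  rewrite (leq_ltn_trans _ rk)// -addsmxE.
  by rewrite (leq_trans (mxrank_adds_leqif _ _))// leq_add2l rank_leq_row.
move: Cv; rewrite mul_col_mx -[0]vsubmxK linear0 => /eq_col_mx [Wv].
rewrite linear0 => Uv.
exists (col_mx v U); split.
- rewrite (tr_col_mx v U) (mul_col_row v U v^T U^T) UU Uv.
  rewrite -[v *m U^T]trmxK trmx_mul trmxK Uv trmx0.
  rewrite [v *m v^T](_ : _ = 1%:M) -?scalar_mx_block//.
  by apply/matrixP => i j; rewrite !ord1 -dotrE vv mxE.
- by rewrite (tr_col_mx v U) (mul_mx_row W v^T U^T) Wv WU row_mx0.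
- rewrite -Umax; apply/rowP => i; rewrite [LHS]mxE [RHS]mxE.
  have -> : ord_max = @rshift 1 k.+1 ord_max by exact: ord_inj.
  by rewrite (col_mxEd v U).
Qed.

End linear_algebra.

(** * Columns of the inverse as the basis dual to the rows *)

Section inverse_columns.
Variables (R : rcfType) (n : nat).
Implicit Types (N M : 'M[R]_n) (x u : 'rV[R]_n).

Definition set_row (j : 'I_n) M x : 'M[R]_n :=
  \matrix_(i, k) if i == j then x 0 k else M i k.

Lemma row_set_row_eq j M x : row j (set_row j M x) = x.
Proof. by apply/rowP => k; rewrite !mxE eqxx. Qed.

Lemma row_set_row_neq j M x i : i != j -> row i (set_row j M x) = row i M.
Proof. by move=> /negPf ij; apply/rowP => k; rewrite !mxE ij. Qed.

(* For invertible [N] this is dist(row j N, span of the other rows)^-2; for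
   singular [N], [invmx] makes it a junk value. *)
Definition inv_dist2 N (j : 'I_n) : R := \sum_i invmx N i j ^+ 2.

Lemma inv_dist2_ge0 N j : 0 <= inv_dist2 N j.
Proof. by apply: sumr_ge0 => i _; rewrite sqr_ge0. Qed.

(** The columns b_k of the inverse are dual to the rows of [N], so the coefficient of [u] along b_k
    is its inner product with row k. *)
Lemma invmx_expand N u : N \in unitmx ->
  forall i, u 0 i = \sum_k dotr (row k N) u * invmx N i k.
Proof.
move=> Nu i; have /(congr1 (fun A : 'cV[R]_n => A i 0)) := mulKmx Nu u^T.
rewrite !mxE => <-; apply: eq_bigr => k _; rewrite mulrC; congr (_ * _).
by rewrite !mxE /dotr; apply: eq_bigr => l _; rewrite !mxE.
Qed.

(** In the expansion of [u] along the columns of the inverse only the j-th term survives; take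
    squared norms. *)
Lemma inv_dist2_normal N j u : N \in unitmx -> dotr u u = 1 ->
    (forall k, k != j -> dotr (row k N) u = 0) ->
  dotr (row j N) u ^+ 2 * inv_dist2 N j = 1.
Proof.
move=> Nu uu orth; rewrite -uu /inv_dist2 mulr_sumr; apply: eq_bigr => i _.
rewrite -expr2 (invmx_expand u Nu) (bigD1 j)//= big1 ?addr0 ?exprMn//.
by move=> k kj; rewrite orth ?mul0r.
Qed.

(** The normal [v] is a multiple of b_j, hence [u] is orthogonal to b_j. Pairing the expansion of
    [u] with b_j writes the product of [dotr (row j N) u] and |b_j|^2 as minus the sum over [J] of
    [dotr (row i N) u] times the inner product of b_i and b_j. Cauchy-Schwarz, |b_i| <= tau and
    |b_j| >= q tau finish. This bounds the three long sides of the box. *)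
Lemma dotr_row_le N j (J : {set 'I_n}) u v (q tau : R) : N \in unitmx ->
    j \notin J -> 0 < q -> 0 < tau ->
    (q * tau) ^+ 2 <= inv_dist2 N j ->
    (forall i, i \in J -> inv_dist2 N i <= tau ^+ 2) ->
    dotr v v = 1 -> (forall k, k != j -> dotr (row k N) v = 0) ->
    dotr u v = 0 ->
    (forall k, k != j -> k \notin J -> dotr (row k N) u = 0) ->
  `|dotr (row j N) u| <= q^-1 * \sum_(i in J) `|dotr (row i N) u|.
Proof.
move=> Nu jJ q0 t0 rj rJ vv vorth uv uorth.
pose h := dotr (row j N) v.
have vE i : v 0 i = h * invmx N i j.
  rewrite (invmx_expand v Nu) (bigD1 j)//= big1 ?addr0//.
  by move=> k kj; rewrite vorth ?mul0r.
have h0 : h != 0.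
  apply/eqP => h0; have := inv_dist2_normal Nu vv vorth.
  by rewrite -/h h0 expr0n mul0r => /esym/eqP; rewrite oner_eq0.
pose c k := \sum_i invmx N i k * invmx N i j.
have : \sum_k dotr (row k N) u * c k = 0.
  apply/(mulfI h0); rewrite mulr0 -{}[RHS]uv mulr_sumr /dotr.
  under [RHS]eq_bigr do rewrite vE (invmx_expand u Nu) mulr_suml.
  rewrite [RHS]exchange_big; apply: eq_bigr => k _ /=.
  rewrite !mulr_sumr; apply: eq_bigr => i _.
  by rewrite mulrCA -!mulrA; congr (_ * _); rewrite mulrCA.
rewrite (bigD1 j)//= (bigID (mem J))/= [X in _ + (_ + X)]big1 ?addr0; last first.
  by move=> k /andP[kj kJ]; rewrite uorth ?mul0r.
rewrite (eq_bigl (mem J)) => [|k]; last first.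
  by rewrite /= andbC; apply: andb_idr => kJ; apply: contraNneq jJ => <-.
have -> : c j = inv_dist2 N j by [].
move=> /eqP; rewrite addr_eq0 => /eqP eq_sum.
pose s k := Num.sqrt (inv_dist2 N k).
have ss k : s k ^+ 2 = inv_dist2 N k by rewrite sqr_sqrtr ?inv_dist2_ge0.
have qt0 : 0 < q * tau by rewrite mulr_gt0.
have sj : q * tau <= s j by rewrite -(ler_pXn2r (n := 2)) ?nnegrE ?(ltW qt0) ?sqrtr_ge0 ?ss.
have sj0 : 0 < s j by exact: lt_le_trans sj.
have cs k : `|c k| <= s k * s j.
  rewrite -(ler_pXn2r (n := 2)) ?nnegrE ?mulr_ge0 ?sqrtr_ge0// real_normK ?num_real//.
  by rewrite exprMn !ss cauchy_schwarz.
have : `|dotr (row j N) u| * s j * s j <= (\sum_(i in J) `|dotr (row i N) u|) * tau * s j.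
  rewrite -mulrA -expr2 ss -[inv_dist2 N j in X in X <= _]ger0_norm ?inv_dist2_ge0//.
  rewrite -normrM eq_sum normrN (le_trans (ler_norm_sum _ _ _))// -mulrA mulr_suml.
  apply: ler_sum => i iJ; rewrite normrM ler_wpM2l// (le_trans (cs i))//.
  rewrite ler_wpM2r ?(ltW sj0)// -(ler_pXn2r (n := 2)) ?nnegrE ?(ltW t0) ?sqrtr_ge0 ?ss//.
  exact: rJ.
rewrite ler_pM2r// => le1.
rewrite mulrC ler_pdivlMr// -(ler_pM2r t0) -mulrA (le_trans _ le1)//.
by rewrite ler_wpM2l.
Qed.

End inverse_columns.

(** * Projection onto the complement of the rows outside J *)

Section residual_projection.
Variables (R : rcfType) (n : nat) (J : {set 'I_n}).
Implicit Types (M N : 'M[R]_n) (x u : 'rV[R]_n).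

Definition mask : 'M[R]_n := diag_mx (\row_k (k \in J)%:R).

(** Rows in [J] are zeroed rather than deleted, so that the size does not depend on [J]. *)
Definition outer_rows M : 'M[R]_n :=
  \matrix_(i, k) if i \in J then 0 else M i k.

Definition outer_gram M : 'M[R]_n := outer_rows M *m (outer_rows M)^T + mask.

(* Adding [mask] makes the Gram matrix invertible as soon as the rows outside
   [J] are independent; then [residual M] is the orthogonal projection onto the
   orthogonal complement of these rows, and it depends measurably on [M]. *)
Definition residual M : 'M[R]_n :=
  1%:M - (outer_rows M)^T *m invmx (outer_gram M) *m outer_rows M.

Lemma outer_rows_set_row i M x : i \in J ->
  outer_rows (set_row i M x) = outer_rows M.
Proof.
move=> iJ; apply/matrixP => k l; rewrite !mxE; case: ifP => // kJ.
by case: eqP => // ki; rewrite ki iJ in kJ.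
Qed.

Lemma mask_mulmx m (A : 'M[R]_(n, m)) i k :
  (mask *m A) i k = if i \in J then A i k else 0.
Proof. by rewrite mul_diag_mx !mxE; case: (i \in J); rewrite ?mul1r ?mul0r. Qed.

Lemma mask_idem : mask *m mask = mask.
Proof. by apply/matrixP => i k; rewrite mask_mulmx !mxE; case: (i \in J); rewrite ?mul0rn. Qed.

Lemma mask_outer_rows M : mask *m outer_rows M = 0.
Proof. by apply/matrixP => i k; rewrite mask_mulmx !mxE; case: (i \in J). Qed.

Lemma mask_sym : mask^T = mask.
Proof. exact: tr_diag_mx. Qed.

Lemma outer_rows_orth M u : (forall k, k \notin J -> dotr (row k M) u = 0) ->
  outer_rows M *m u^T = 0.
Proof.
move=> orth; apply/colP => k; rewrite !mxE.
have [kJ|kJ] := boolP (k \in J).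
  by rewrite big1// => i _; rewrite !mxE kJ mul0r.
rewrite -[RHS](orth k kJ); apply: eq_bigr => i _.
by rewrite !mxE (negPf kJ).
Qed.

Lemma outer_rows_orthP M u k : outer_rows M *m u^T = 0 -> k \notin J ->
  dotr (row k M) u = 0.
Proof.
move=> /(congr1 (fun A : 'cV[R]_n => A k 0)); rewrite !mxE => <- kJ.
by apply: eq_bigr => i _; rewrite !mxE (negPf kJ).
Qed.

(** If [v] is in the kernel of the Gram matrix, pairing with [v] makes both |v W|^2 and |v mask|^2
    vanish, W being [outer_rows N]. So [v] is zero on [J], whence v N = v W = 0 and v = 0. *)
Lemma outer_gram_unit N : N \in unitmx -> outer_gram N \in unitmx.
Proof.
move=> Nu; rewrite -row_free_unit -kermx_eq0; apply/rowV0P => v.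
move=> /sub_kermxP vG.
have : dotr (v *m outer_rows N) (v *m outer_rows N) + dotr (v *m mask) (v *m mask) = 0.
  rewrite !dotrE !trmx_mul mask_sym -!mulmxA (mulmxA mask) mask_idem.
  rewrite (mulmxA (outer_rows N)) !mulmxA.
  have := congr1 (mulmx^~ v^T) vG.
  rewrite mul0mx => /(congr1 (fun A : 'M[R]_1 => A 0 0)).
  by rewrite mulmxDr mulmxDl !mulmxA [in X in X -> _]mxE => ->; rewrite mxE.
move=> /eqP; rewrite paddr_eq0 ?dotr_ge0// => /andP[/eqP/dotr_eq0 vW /eqP/dotr_eq0 vm].
have vJ k : k \in J -> v 0 k = 0.
  move=> kJ; have /(congr1 (fun A : 'rV[R]_n => A 0 k)) := vm.
  by rewrite mul_mx_diag !mxE kJ mulr1.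
apply: (row_free_inj (A := N)); first by rewrite row_free_unit.
rewrite mul0mx -[RHS]vW; apply/rowP => i; rewrite !mxE; apply: eq_bigr => k _.
by rewrite !mxE; case: ifP => // /vJ ->; rewrite !mul0r.
Qed.

Lemma rank_outer_rows M : (\rank (outer_rows M) <= n - #|J|)%N.
Proof.
have -> : (n - #|J| = #|~: J|)%N by rewrite [RHS]cardsCs card_ord finset.setCK.
apply: (@leq_trans (\rank (\sum_(k in ~: J) <<row k M>>)%MS)).
  apply/mxrankS/row_subP => i; have [iJ|iJ] := boolP (i \in J).
    rewrite (_ : row i _ = 0) ?sub0mx//.
    by apply/rowP => k; rewrite !mxE iJ.
  rewrite (_ : row i _ = row i M); last by apply/rowP => k; rewrite !mxE (negPf iJ).
  by rewrite (sumsmx_sup i) ?inE// genmxE.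
rewrite (leq_trans (mxrank_sum_leqif _))//= -sum1_card leq_sum// => i _.
by rewrite genmxE rank_leq_row.
Qed.

Lemma residual_id M u : outer_rows M *m u^T = 0 -> residual M *m u^T = u^T.
Proof.
move=> Wu; rewrite /residual mulmxBl mul1mx -(mulmxA _ (outer_rows M)) Wu.
by rewrite mulmx0 subr0.
Qed.

Lemma residual_sym M : (residual M)^T = residual M.
Proof.
have Gs : (outer_gram M)^T = outer_gram M.
  by rewrite linearD/= trmx_mul trmxK mask_sym.
by rewrite linearB/= trmx1 !trmx_mul trmxK trmx_inv Gs mulmxA.
Qed.

(** The residual is symmetric and idempotent, so the sum of its squared entries is its trace. Both
    the idempotence and the trace follow from W W^T = G - mask and mask G^-1 = mask. *)
Lemma residual_trace M : outer_gram M \in unitmx ->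
  \sum_i \sum_k residual M i k ^+ 2 = #|J|%:R.
Proof.
move=> Gu; set W := outer_rows M; set G := outer_gram M.
have mG : mask *m G = mask.
  by rewrite mulmxDr mulmxA mask_outer_rows mul0mx add0r mask_idem.
have mGi : mask *m invmx G = mask by rewrite -[in LHS]mG mulmxK.
have WW : W *m W^T = G - mask by rewrite /G addrK.
have trP : \tr (residual M) = #|J|%:R.
  rewrite linearB /= mxtrace1 mxtrace_mulC mulmxA WW mulmxBl mGi mulmxV// linearB/=.
  rewrite mxtrace1 opprB addrC subrK mxtrace_diag.
  under eq_bigr do rewrite mxE.
  by rewrite -sumr_const [RHS]big_mkcond; apply: eq_bigr => i _; case: (i \in J).
have PP : residual M *m residual M = residual M.
  have Q : W^T *m invmx G *m W *m (W^T *m invmx G *m W) = W^T *m invmx G *m W.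
    rewrite -!mulmxA (mulmxA W) WW (mulmxA (G - _)) mulmxBl mulmxV// mGi.
    by rewrite mulmxBl mul1mx mask_outer_rows subr0.
  by rewrite /residual -/W -/G mulmxBl mul1mx mulmxBr mulmx1 Q subrr subr0.
rewrite -trP; apply: eq_bigr => i _.
rewrite -[in RHS]PP mxE; apply: eq_bigr => k _.
by rewrite expr2; congr (_ * _); rewrite -[in LHS]residual_sym [LHS]mxE.
Qed.

Lemma dotr_le_residual M x u : outer_rows M *m u^T = 0 -> dotr u u = 1 ->
  `|dotr x u| <= Num.sqrt (dotr (x *m residual M) (x *m residual M)).
Proof.
move=> Wu uu; rewrite -sqrtr_sqr ler_wsqrtr//.
have -> : dotr x u = dotr (x *m residual M) u by rewrite !dotrE -mulmxA residual_id.
rewrite (le_trans (cauchy_schwarz _ _))//.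
by rewrite [X in _ * X](_ : _ = 1) ?mulr1// -uu.
Qed.

End residual_projection.

(** * Densities and boxes *)

Section lebesgue_box.
Variable R : realType.

Definition slab_box m (d : 'I_m -> R) : set 'rV[R]_m :=
  [set v | forall k, `|v 0 k| <= d k].

Lemma measurable_forall_fin d (T : measurableType d) (I : finType) (P : I -> set T) :
  (forall i, measurable (P i)) -> measurable [set x | forall i, P i x].
Proof.
move=> mP; rewrite (_ : [set x | _] = \big[setI/setT]_i P i).
  exact: bigsetI_measurable.
apply/seteqP; split => [x Px|x + i]; first by elim/big_ind : _.
by rewrite (bigD1 i)//= => -[].
Qed.

Lemma measurable_le_set d (T : measurableType d) (f g : T -> R) :
  measurable_fun setT f -> measurable_fun setT g -> measurable [set x | f x <= g x].
Proof.
move=> mf mg; rewrite -[X in measurable X]setTI.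
exact: measurable_fun_le.
Qed.

Lemma measurable_slab_box m (d : 'I_m -> R) : measurable (slab_box d).
Proof.
apply: measurable_forall_fin => k; apply: measurable_le_set => //.
by apply: measurableT_comp => //; exact: measurable_mx_entry.
Qed.

Lemma lebesgue_slab_box m (d : 'I_m -> R) : (forall k, 0 <= d k) ->
  lebesgue_rV (slab_box d) = (\prod_k (2 * d k))%:E.
Proof.
elim: m d => [|m IH] d d0.
  rewrite big_ord0 /= diracE mem_set// => -[]//.
rewrite big_ord_recl /=.
rewrite /pushforward (_ : _ @^-1` _ = `[- d ord0, d ord0] `*` slab_box (fun k => d (lift ord0 k))).
  rewrite product_measure1E//; last exact: measurable_slab_box.
  rewrite EFinM; congr (_ * _)%E; last exact: IH.
  have /= -> := lebesgue_measure_itv `[- d ord0, d ord0]; rewrite lte_fin.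
  case: ifPn => [_|]; first by rewrite -EFinB; congr EFin; ring.
  (* The interval formula returns 0 when the endpoints are not strictly ordered; here this forces
     the side to be 0. *)
  by rewrite -leNgt => d1; congr EFin; have := d0 ord0; lra.
have rowl (x : R) (v : 'rV[R]_m) : (row_mx x%:M v : 'rV_(1 + m)) 0 ord0 = x.
  have -> : @ord0 m = lshift m (@ord0 0) by exact: ord_inj.
  by rewrite (row_mxEl x%:M v) mxE eqxx.
have rowr (x : R) (v : 'rV[R]_m) k :
    (row_mx x%:M v : 'rV_(1 + m)) 0 (lift ord0 k) = v 0 k.
  have -> : lift (@ord0 m) k = rshift 1 k by exact: ord_inj.
  by rewrite (row_mxEr x%:M v).
apply/seteqP; split => [[x v] b|[x v] [/= bx bv] k].
  split => [|k] /=.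
    by have := b ord0; rewrite (rowl x v) in_itv/= -ler_norml.
  by have := b (lift ord0 k); rewrite (rowr x v).
have [->|[l ->]] : k = ord0 \/ exists l, k = lift ord0 l.
    by case: (unliftP ord0 k) => [l|] ->; [right; exists l|left].
  by rewrite (rowl x v); move: bx; rewrite in_itv/= -ler_norml.
by rewrite (rowr x v); exact: bv.
Qed.

End lebesgue_box.

Section density_bound.
Variable R : realType.

Lemma measurable_mxlinear n p (A : 'M[R]_(n, p)) :
  measurable_fun setT (fun v : 'rV[R]_n => v *m A).
Proof.
apply: measurable_fun_mx => i j.
rewrite (_ : (fun _ => _) = (fun v : 'rV[R]_n => \sum_k v i k * A k j)); last first.
  by apply/funext => v; rewrite mxE.
apply: measurable_sum => k; apply: measurable_funM => //.
exact: measurable_mx_entry.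
Qed.

Lemma measurable_dotr n (u : 'rV[R]_n) :
  measurable_fun setT (fun v : 'rV[R]_n => dotr v u).
Proof.
apply: measurable_sum => k; apply: measurable_funM => //.
exact: measurable_mx_entry.
Qed.

Lemma measurable_subspace_set n (F : 'M[R]_n) : measurable (subspace_set F).
Proof.
rewrite /subspace_set (_ : [set x | _] = 
  [set x : 'rV[R]_n | forall k, `|(x *m cokermx F) 0 k| <= 0]).
  apply: measurable_forall_fin => k; apply: measurable_le_set => //.
  apply: measurableT_comp => //.
  have := measurable_mxlinear (cokermx F) => /(measurableT_comp (measurable_mx_entry 0 k)).
  exact.
apply/seteqP; split => x /=.
  by rewrite submxE => /eqP -> k; rewrite mxE normr0.
move=> x0; rewrite submxE; apply/eqP/rowP => k; rewrite [RHS]mxE; apply/eqP.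
by have := x0 k; rewrite normr_le0.
Qed.

(** By positivity of the inner product [F] meets [kermx F^T] only in 0, so the two span the whole
    space and the discarded component of [x] is orthogonal to [u]. *)
Lemma orthoproj_dotr n (F : 'M[R]_n) (x u : 'rV[R]_n) : (u <= F)%MS ->
  dotr (x *m orthoproj F) u = dotr x u.
Proof.
have cap0 : (F :&: kermx F^T = 0)%MS.
  apply/eqP/rowV0P => v; rewrite sub_capmx => /andP[/submxP[w ->] /sub_kermxP wF].
  by apply: dotr_eq0; rewrite dotrE trmx_mul mulmxA wF mul0mx mxE.
move=> /submxP[w ->].
have sumF : (x <= F + kermx F^T)%MS.
  apply: submx_full; rewrite /row_full eqn_leq rank_leq_col /=.
  by rewrite (mxrank_disjoint_sum cap0) mxrank_ker mxrank_tr subnKC// rank_leq_row.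
have := add_proj_mx cap0 sumF; set p := x *m proj_mx F _; set q := (X in _ + X = _) => <-.
rewrite /orthoproj -/p.
have : (q <= kermx F^T)%MS by exact: proj_mx_sub.
move=> /sub_kermxP qF.
by rewrite !dotrE mulmxDl trmx_mul mulmxA mulmxA qF mul0mx addr0.
Qed.

Context d (T : measurableType d) (P : probability T R).

(** The event depends only on the projection of [X] to the row space of [U], so its probability is
    at most [K] times a volume. In the coordinates given by the rows of [U] the region is a box. *)
Lemma slab_prob_le n m (K : R) (X : T -> 'rV[R]_n) (U : 'M[R]_(m, n))
    (e : 'I_m -> R) :
  0 <= K -> (forall k, 0 <= e k) ->
  proj_density_bounded P m K X -> U *m U^T = 1%:M ->
  (P [set w | forall k, (`|dotr (X w) (row k U)| <= e k)%R] <=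
   (K * \prod_k (2 * e k))%:E)%E.
Proof.
move=> K0 e0 dX UU.
have Ufree : row_free U by apply/row_freeP; exists U^T.
pose F := <<U>>%MS.
have rF : \rank F = m by rewrite mxrank_gen; exact/eqP.
have oF : orthonormal_basis F U by split => //; exact/eqmx_sym/genmxE.
have [f [[mf f0 fP] fK]] := dX F rF U oF.
pose B : set 'rV[R]_n := [set x | forall k, `|dotr x (row k U)| <= e k].
have mB : measurable B.
  apply: measurable_forall_fin => k; apply: measurable_le_set => //.
  apply: measurableT_comp => //; exact: measurable_dotr.
rewrite (_ : [set w | _] = (fun w => X w *m orthoproj F) @^-1` B); last first.
  apply/seteqP; split => w /= Bw k; have := Bw k;
    by rewrite orthoproj_dotr// genmxE row_sub.
rewrite fP//.
pose mu := pushforward (lebesgue_rV (R := R) (m := m)) (fun x : 'rV[R]_m => x *m U).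
pose nu : {measure set 'rV[R]_n -> \bar R} :=
  measure_function_pushforward__canonical__measure_function_Measure
    (lebesgue_rV (R := R) (m := m)) (measurable_mxlinear U).
rewrite [X in (X <= _)%E](_ : _ = (\int[nu]_(x in subspace_set F `&` B) (f x)%:E)%E)//.
have mFB : measurable (subspace_set F `&` B).
  by apply: measurableI => //; exact: measurable_subspace_set.
apply: (@le_trans _ _ (\int[nu]_(x in subspace_set F `&` B) K%:E)%E).
  apply: ge0_le_integral => //.
  - by move=> x [Fx _]; rewrite lee_fin f0.
  - apply/measurable_EFinP; apply: measurable_funS mf; first exact: measurable_subspace_set.
    exact: subIsetl.
  - by move=> x [Fx _]; rewrite lee_fin fK.
rewrite integral_cst// EFinM lee_wpmul2l ?lee_fin//.
apply: (@le_trans _ _ (nu B)).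
  by apply: le_measure; rewrite ?inE//; exact: subIsetr.
rewrite /nu /= /pushforward (_ : _ @^-1` B = slab_box e) ?lebesgue_slab_box//.
have coord v k : dotr (v *m U) (row k U) = v 0 k.
  transitivity ((v *m U *m U^T) 0 k); last by rewrite -mulmxA UU mulmx1.
  by rewrite [RHS]mxE; apply: eq_bigr => i _; rewrite [row k U 0 i]mxE [U^T i k]mxE.
by apply/seteqP; split => v Bv k; have := Bv k; rewrite /= coord.
Qed.

End density_bound.

(** * Resampling one row *)

Section measurable_matrices.
Context d (T : measurableType d) (R : realType).

(** Inversion is continuous away from 0, and any function is measurable on a singleton. *)
Lemma measurable_invr : measurable_fun setT (GRing.inv : R -> R).
Proof.
rewrite -(setvU [set (0 : R)]); apply/measurable_funU => //.
  exact: measurableC.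
split; last exact: measurable_fun_set1.
apply: open_continuous_measurable_fun => [|x].
  by apply: closed_openC; apply: accessible_closed_set1; exact/hausdorff_accessible/norm_hausdorff.
by rewrite inE /= => /eqP; exact: inv_continuous.
Qed.

Lemma measurable_entry m n (f : T -> 'M[R]_(m, n)) i j :
  measurable_fun setT f -> measurable_fun setT (fun w => f w i j).
Proof. by move=> mf; exact: measurableT_comp (measurable_mx_entry i j) mf. Qed.

Lemma measurable_mulmx m n p (f : T -> 'M[R]_(m, n)) (g : T -> 'M[R]_(n, p)) :
  measurable_fun setT f -> measurable_fun setT g ->
  measurable_fun setT (fun w => f w *m g w).
Proof.
move=> mf mg; apply: measurable_fun_mx => i j.
rewrite (_ : (fun _ => _) = fun w => \sum_k f w i k * g w k j); last first.
  by apply/funext => w; rewrite mxE.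
by apply: measurable_sum => k; apply: measurable_funM; exact: measurable_entry.
Qed.

Lemma measurable_trmx m n (f : T -> 'M[R]_(m, n)) :
  measurable_fun setT f -> measurable_fun setT (fun w => (f w)^T).
Proof.
move=> mf; apply: measurable_fun_mx => i j.
rewrite (_ : (fun _ => _) = fun w => f w j i); first exact: measurable_entry.
by apply/funext => w; rewrite mxE.
Qed.

Lemma measurable_row m n (f : T -> 'M[R]_(m, n)) i :
  measurable_fun setT f -> measurable_fun setT (fun w => row i (f w)).
Proof.
move=> mf; apply: measurable_fun_mx => k j.
rewrite (_ : (fun _ => _) = fun w => f w i j); first exact: measurable_entry.
by apply/funext => w; rewrite mxE.
Qed.

Lemma measurable_addmx m n (f g : T -> 'M[R]_(m, n)) :
  measurable_fun setT f -> measurable_fun setT g ->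
  measurable_fun setT (fun w => f w + g w).
Proof.
move=> mf mg; apply: measurable_fun_mx => i j.
rewrite (_ : (fun _ => _) = fun w => f w i j + g w i j); last first.
  by apply/funext => w; rewrite mxE.
by apply: measurable_funD; exact: measurable_entry.
Qed.

Lemma measurable_oppmx m n (f : T -> 'M[R]_(m, n)) :
  measurable_fun setT f -> measurable_fun setT (fun w => - f w).
Proof.
move=> mf; apply: measurable_fun_mx => i j.
rewrite (_ : (fun _ => _) = fun w => - f w i j); last first.
  by apply/funext => w; rewrite mxE.
by apply: measurableT_comp => //; exact: measurable_entry.
Qed.

Lemma measurable_det n (f : T -> 'M[R]_n) :
  measurable_fun setT f -> measurable_fun setT (fun w => \det (f w)).
Proof.
move=> mf; apply: measurable_sum => s; apply: measurable_funM => //.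
by apply: measurable_prod => i _; exact: measurable_entry.
Qed.

Lemma measurable_unitmx n (f : T -> 'M[R]_n) :
  measurable_fun setT f -> measurable [set w | f w \in unitmx].
Proof.
move=> mf; rewrite (_ : [set w | _] = (fun w => \det (f w)) @^-1` (~` [set 0])).
  by rewrite -[X in measurable X]setTI; apply: measurable_det => //; exact: measurableC.
by apply/seteqP; split => w /=; rewrite unitmxE unitfE => /eqP.
Qed.

Lemma measurable_invmx n (f : T -> 'M[R]_n) :
  measurable_fun setT f -> measurable_fun setT (fun w => invmx (f w)).
Proof.
move=> mf; apply: measurable_fun_mx => i j.
(* Cofactor formula on invertible matrices; on singular ones [invmx] returns its argument. *)
rewrite (_ : (fun _ => _) = fun w => if f w \in unitmx then
    (\det (f w))^-1 * ((-1) ^+ (j + i) * \det (row' j (col' i (f w)))) else f w i j); last first.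
  by apply/funext => w; rewrite /invmx; case: ifP => // _; rewrite !mxE.
apply: measurable_fun_ifT.
- apply: (measurable_fun_bool true); rewrite setTI; exact: measurable_unitmx.
- apply: measurable_funM.
    by apply: measurableT_comp; [exact: measurable_invr|exact: measurable_det].
  apply: measurable_funM => //; apply: measurable_det.
  apply: measurable_fun_mx => k l.
  rewrite (_ : (fun _ => _) = fun w => f w (lift j k) (lift i l)); first exact: measurable_entry.
  by apply/funext => w; rewrite !mxE.
- exact: measurable_entry.
Qed.

End measurable_matrices.

Section resampling.
Context d (T : measurableType d) (R : realType) (P : probability T R).
Context (n : nat) (A : {RV P >-> 'M[R]_n}).
Hypothesis indA : mutually_independent P (fun (i : 'I_n) w => row i (A w)).

Definition resample j (p : T * T) : 'M[R]_n := set_row j (A p.1) (row j (A p.2)).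

Lemma measurable_set_row d' (T' : measurableType d') j (f : T' -> 'M[R]_n) (g : T' -> 'rV[R]_n) :
  measurable_fun setT f -> measurable_fun setT g ->
  measurable_fun setT (fun w => set_row j (f w) (g w)).
Proof.
move=> mf mg; apply: measurable_fun_mx => i k.
rewrite (_ : (fun _ => _) = fun w => if i == j then g w 0 k else f w i k).
  by case: (i == j); exact: measurable_entry.
by apply/funext => w; rewrite mxE.
Qed.

Lemma measurable_resample j : measurable_fun setT (resample j).
Proof.
apply: measurable_set_row; last apply: measurable_row; apply: measurableT_comp => //.
Qed.

Let row_rect (B : 'I_n -> set 'rV[R]_n) : set 'M[R]_n :=
  [set M | forall i, B i (row i M)].

(** Products of measurable sets of rows are stable under intersection and generate the
    sigma-algebra, so the uniqueness theorem for measures applies. *)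
Lemma matrix_measure_eq (m1 m2 : {measure set 'M[R]_n -> \bar R}) :
  (m1 setT < +oo)%E ->
  (forall B, (forall i, measurable (B i)) -> m1 (row_rect B) = m2 (row_rect B)) ->
  forall C, measurable C -> m1 C = m2 C.
Proof.
move=> m1T m12; pose G := [set C | exists2 B, (forall i, measurable (B i)) & C = row_rect B].
have GT : G setT by exists (fun=> setT) => //; apply/seteqP; split.
apply: (@measure_unique _ _ _ G (fun=> setT)) => //.
- apply/seteqP; split.
    apply: smallest_sub; first exact: smallest_sigma_algebra.
    move=> _ [i [j [C [mC ->]]]]; apply: sub_sigma_algebra.
    exists (fun k => if k == i then (fun v : 'rV[R]_n => v 0 j) @^-1` C else setT).
      move=> k; case: ifP => // _; rewrite -[X in measurable X]setTI.
      exact: measurable_mx_entry.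
    apply/seteqP; split => M /=.
      by move=> Mij k; case: ifP => // /eqP ->; rewrite /= mxE.
    by move=> /(_ i); rewrite eqxx /= mxE.
  apply: smallest_sub; first exact: sigma_algebra_measurable.
  move=> _ [B mB ->]; apply: measurable_forall_fin => i.
  rewrite -[X in measurable X]setTI.
  by apply: (@measurable_row _ _ _ _ _ id) => //.
- move=> _ _ [B mB ->] [B' mB' ->]; exists (fun i => B i `&` B' i).
    by move=> i; exact: measurableI.
  by apply/seteqP; split => [M [a b] i|M ab]; [split|split => i; have [] := ab i].
- by rewrite bigcup_const.
- by move=> _ [B mB ->]; exact: m12.
Qed.

Let measurable_preimage_row i (B : set 'rV[R]_n) : measurable B ->
  measurable ((fun w => row i (A w)) @^-1` B).
Proof.
move=> mB; rewrite -[X in measurable X]setTI.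
by apply: measurable_row.
Qed.

(** Taking row j from an independent copy does not change the law: by independence of the rows both
    sides are the same product on rectangles. *)
Lemma resample_prob j (C : set 'M[R]_n) : measurable C ->
  P (A @^-1` C) = (P \x P)%E (resample j @^-1` C).
Proof.
have mA : measurable_fun setT A by [].
pose m1 : {measure set 'M[R]_n -> \bar R} :=
  measure_function_pushforward__canonical__measure_function_Measure P mA.
pose m2 : {measure set 'M[R]_n -> \bar R} :=
  measure_function_pushforward__canonical__measure_function_Measure
    (P \x P)%E (measurable_resample j).
apply: (@matrix_measure_eq m1 m2) => [|B mB].
  by rewrite /m1 /= /pushforward preimage_setT probability_setT ltry.
rewrite /m1 /m2 /= /pushforward.
pose S (J : {set 'I_n}) : set T := \bigcap_(i in [set` J]) (fun w => row i (A w)) @^-1` B i.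
have mS (J : {set 'I_n}) : measurable (S J).
  by apply: fin_bigcap_measurable => // i _; exact: measurable_preimage_row.
transitivity (P (S [set: 'I_n]%SET)).
  congr (P _); apply/seteqP; split => [w Bw i _|w Sw i]; first exact: Bw.
  by apply: Sw; rewrite /= inE.
transitivity ((P \x P)%E (S (~: [set j])%SET `*` (fun w => row j (A w)) @^-1` B j)); last first.
  congr ((P \x P)%E _); apply/seteqP; split => [[w' w] [/= Sw Bw] i|[w' w] Bw].
    have [->|ij] := eqVneq i j; first by rewrite row_set_row_eq.
    by rewrite row_set_row_neq//; apply: Sw; rewrite /= !inE.
  split => [i|] /=; last by have := Bw j; rewrite /= row_set_row_eq.
  by rewrite /= !inE => ij; have := Bw i; rewrite /= row_set_row_neq.
rewrite product_measure1E//; last exact: measurable_preimage_row.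
pose p i := fine (P ((fun w => row i (A w)) @^-1` B i)).
transitivity ((\prod_(i in (~: [set j])%SET) p i)%:E * (p j)%:E)%E; last first.
  congr (_ * _)%E; first by rewrite [RHS]indA.
  by rewrite fineK// fin_num_measure//; exact: measurable_preimage_row.
rewrite [LHS]indA// -EFinM; congr EFin; rewrite mulrC (bigD1 j) ?inE//=.
by congr (_ * _); apply: eq_bigl => i; rewrite !inE.
Qed.

Lemma resample_integral j (g : 'M[R]_n -> \bar R) :
    measurable_fun setT g -> (forall M, (0 <= g M)%E) ->
  (\int[P]_w g (A w) =
   \int[P]_w' \int[P]_w g (set_row j (A w') (row j (A w))))%E.
Proof.
move=> mg g0.
have mA : measurable_fun setT A by [].
pose m1 : {measure set 'M[R]_n -> \bar R} :=
  measure_function_pushforward__canonical__measure_function_Measure P mA.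
pose m2 : {measure set 'M[R]_n -> \bar R} :=
  measure_function_pushforward__canonical__measure_function_Measure
    (P \x P)%E (measurable_resample j).
transitivity (\int[m1]_M g M)%E.
  by rewrite ge0_integral_pushforward// preimage_setT.
transitivity (\int[m2]_M g M)%E.
  by apply: eq_measure_integral => C mC _; exact: resample_prob.
transitivity (\int[(P \x P)%E]_p g (resample j p))%E.
  by rewrite ge0_integral_pushforward//; exact: measurable_resample.
rewrite fubini_tonelli1//.
exact: measurableT_comp mg (measurable_resample j).
Qed.

(** This replaces conditioning on all rows but row j: an estimate for fixed [M], with only row j
    random, is integrated over the law of [A]. *)
Lemma resample_prob_le j (C : set 'M[R]_n) (h : 'M[R]_n -> \bar R) :
    measurable C -> measurable_fun setT h ->
    (forall M, (P [set w | C (set_row j M (row j (A w)))] <= h M)%E) ->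
  (P (A @^-1` C) <= \int[P]_w h (A w))%E.
Proof.
move=> mC mh hC.
have mg : measurable_fun setT (fun M => (\1_C M)%:E : \bar R).
  by apply/measurable_EFinP; exact: measurable_indic.
have mC' M : measurable [set w | C (set_row j M (row j (A w)))].
  rewrite -[X in measurable X]setTI.
  by apply: measurable_set_row => //; apply: measurable_row.
rewrite -[X in P X]setIT -integral_indic//; last first.
  by rewrite -[X in measurable X]setTI; apply: measurable_funP.
rewrite (resample_integral j mg); last by move=> M; rewrite lee_fin.
have EC M : (\int[P]_w (\1_C (set_row j M (row j (A w))))%:E)%E =
    P [set w | C (set_row j M (row j (A w)))].
  by rewrite (integral_indic P measurableT (mC' M)) setIT.
under eq_integral do rewrite EC.
apply: ge0_le_integral => //.
- rewrite (_ : (fun _ => _) = fubini_F P (fun p => (\1_C (resample j p))%:E)).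
    apply: measurable_fun_fubini_tonelli_F => //.
    exact: measurableT_comp mg (measurable_resample j).
  by apply/funext => w; rewrite /fubini_F -EC.
- exact: measurableT_comp.
Qed.

End resampling.

(** * Second moment of a linear image of an isotropic vector *)

Section second_moment.
Context d (T : measurableType d) (R : realType) (P : probability T R).

Lemma isotropic_second_moment n (X : T -> 'rV[R]_n) (Q : 'M[R]_n) :
  measurable_fun setT X -> isotropic P X ->
  (\int[P]_w (dotr (X w *m Q) (X w *m Q))%:E = (\sum_i \sum_k Q i k ^+ 2)%:E)%E.
Proof.
move=> mX [EX covX].
have EXX i l : (\int[P]_w (X w 0 i * X w 0 l)%:E = (i == l)%:R%:E)%E.
  rewrite -covX unlock !EX /= unlock; apply: eq_integral => w _.
  by rewrite -[X w 0 i in LHS]subr0 -[X w 0 l in LHS]subr0.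
have mXX i l : measurable_fun setT (fun w => X w 0 i * X w 0 l).
  by apply: measurable_funM; exact: measurable_entry.
have intXii i : P.-integrable setT (fun w => (X w 0 i * X w 0 i)%:E).
  apply/integrableP; split; first exact/measurable_EFinP.
  under eq_integral => w _ do rewrite gee0_abs ?lee_fin -?expr2 ?sqr_ge0//.
  by under eq_integral => w _ do rewrite expr2; rewrite EXX eqxx ltry.
(* Cross terms are dominated through |a b| <= a^2 + b^2; their integrability lets the finite sum
   leave the integral. *)
have intXX i l : P.-integrable setT (fun w => (X w 0 i * X w 0 l)%:E).
  have intD := integrableD measurableT (intXii i) (intXii l).
  apply: (le_integrable measurableT _ _ intD); first exact/measurable_EFinP.
  move=> w _; rewrite -EFinD lee_fin [X in _ <= X]ger0_norm ?addr_ge0 -?expr2 ?sqr_ge0//.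
  rewrite ler_norml; set a := X w 0 i; set b := X w 0 l.
  have := sqr_ge0 (a + b); have := sqr_ge0 (a - b); have := sqr_ge0 a; have := sqr_ge0 b.
  by nra.
transitivity (\int[P]_w (\sum_(p : 'I_n * 'I_n * 'I_n)
    (Q p.1.1 p.2 * Q p.1.2 p.2)%:E * (X w 0 p.1.1 * X w 0 p.1.2)%:E))%E.
  apply: eq_integral => w _; rewrite /dotr.
  under [RHS]eq_bigr do rewrite -EFinM.
  rewrite sumEFin -(pair_bigA _ (fun (q : 'I_n * 'I_n) k =>
    Q q.1 k * Q q.2 k * (X w 0 q.1 * X w 0 q.2)))/=.
  rewrite exchange_big/=; congr EFin; apply: eq_bigr => k _; rewrite mxE.
  rewrite mulr_suml -(pair_bigA _ (fun i l => Q i k * Q l k * (X w 0 i * X w 0 l)))/=.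
  apply: eq_bigr => i _; rewrite mulr_sumr; apply: eq_bigr => l _; ring.
rewrite integral_sum//; last first.
  by move=> p; exact: integrableZl.
under eq_bigr => p _ do rewrite integralZl// EXX -EFinM.
rewrite sumEFin -(pair_bigA _ (fun (q : 'I_n * 'I_n) k => Q q.1 k * Q q.2 k * (q.1 == q.2)%:R))/=.
rewrite -(pair_bigA _ (fun i l => \sum_k Q i k * Q l k * (i == l)%:R))/=.
congr EFin; apply: eq_bigr => i _; rewrite (bigD1 i)//= [X in _ + X]big1 ?addr0.
  by apply: eq_bigr => k _; rewrite eqxx mulr1 expr2.
by move=> l /negPf li; rewrite big1// => k _; rewrite eq_sym li mulr0.
Qed.

End second_moment.

(** * Almost sure invertibility and small ball estimates *)

Section small_ball.
Context d (T : measurableType d) (R : realType) (P : probability T R).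
Context (n : nat) (A : {RV P >-> 'M[R]_n}) (K : R).
Hypothesis indA : mutually_independent P (fun (i : 'I_n) w => row i (A w)).
Hypothesis K_gt0 : 0 < K.
Hypothesis dens1 : forall i, proj_density_bounded P 1 K (fun w => row i (A w)).

Lemma unit_vector_orth_rows (M : 'M[R]_n) j :
  exists2 v : 'rV[R]_n, dotr v v = 1 & forall k, k != j -> dotr (row k M) v = 0.
Proof.
have [|v vv Wv] := @unit_vector_orth _ _ _ (outer_rows [set j] M).
  rewrite (leq_ltn_trans (rank_outer_rows _ _))// cards1 subn1 ltn_predL.
  by case: n j => // -[].
exists v => // k kj; apply: outer_rows_orthP Wv _; by rewrite inE.
Qed.

Lemma slab1_prob_le i (v : 'rV[R]_n) (e : R) : dotr v v = 1 -> 0 <= e ->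
  (P [set w | (`|dotr (row i (A w)) v| <= e)%R] <= (K * (2 * e))%:E)%E.
Proof.
move=> vv e0; have vv1 : v *m v^T = 1%:M.
  by apply/matrixP => a b; rewrite !ord1 -dotrE vv mxE.
have := slab_prob_le (ltW K_gt0) (fun _ : 'I_1 => e0) (dens1 i) vv1.
rewrite big_ord1 (_ : [set w | _] = [set w | `|dotr (row i (A w)) v| <= e])//.
apply/seteqP; split => w /=; first by move=> /(_ ord0); rewrite row_id.
by move=> le_e k; rewrite row_id.
Qed.

Lemma measurable_inv_dist2 d' (T' : measurableType d') (f : T' -> 'M[R]_n) j :
  measurable_fun setT f -> measurable_fun setT (fun w => inv_dist2 (f w) j).
Proof.
move=> mf; apply: measurable_sum => i; apply: measurable_funX.
by apply: measurable_entry; exact: measurable_invmx.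
Qed.

Lemma prob_preimage_le (C : set 'M[R]_n) (c : R) j : measurable C -> 0 <= c ->
  (forall M, (P [set w | C (set_row j M (row j (A w)))] <= c%:E)%E) ->
  (P (A @^-1` C) <= c%:E)%E.
Proof.
move=> mC c0 hC; apply: (le_trans (resample_prob_le indA mC (h := cst c%:E) _ hC)) => //.
by rewrite integral_cst//= probability_setT mule1.
Qed.

Lemma le_prob (B C : set T) : measurable B -> measurable C -> B `<=` C ->
  (P B <= P C)%E.
Proof. by move=> mB mC BC; apply: le_measure; rewrite ?inE. Qed.

Lemma measurable_slab i (v : 'rV[R]_n) (e : R) :
  measurable [set w | `|dotr (row i (A w)) v| <= e].
Proof.
apply: measurable_le_set => //; apply: measurableT_comp => //.
apply: measurableT_comp (measurable_dotr v) _; exact: measurable_row.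
Qed.

Lemma measurable_setrow_preimage (C : set 'M[R]_n) j M : measurable C ->
  measurable [set w | C (set_row j M (row j (A w)))].
Proof.
move=> mC; rewrite -[X in measurable X]setTI.
by apply: measurable_set_row => //; apply: measurable_row.
Qed.

(** The condition is |b_j| >= u; invertibility is included because [inv_dist2] is junk on singular
    matrices. *)
Definition large_col j (u : R) : set 'M[R]_n :=
  [set N | N \in unitmx /\ u ^+ 2 <= inv_dist2 N j].

Lemma measurable_large_col j u : measurable (large_col j u).
Proof.
apply: measurableI; first exact: (@measurable_unitmx _ _ _ _ id).
by apply: measurable_le_set => //; exact: (@measurable_inv_dist2 _ _ id).
Qed.

Lemma large_col_slab (N : 'M[R]_n) j (u : R) v : 0 < u -> large_col j u N -> dotr v v = 1 ->
  (forall k, k != j -> dotr (row k N) v = 0) -> `|dotr (row j N) v| <= u^-1.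
Proof.
move=> u0 [Nu rj] vv orth; have := inv_dist2_normal Nu vv orth.
set h := dotr _ _ => h1.
rewrite -(ler_pXn2r (n := 2)) ?nnegrE ?invr_ge0 ?(ltW u0)// real_normK ?num_real//.
rewrite exprVn -[X in _ <= X]mul1r ler_pdivlMr ?exprn_gt0// -h1.
by rewrite ler_wpM2l ?sqr_ge0.
Qed.

(** A unit normal to the other rows does not change when row j is resampled, and the event puts row
    j in a slab of half-width 1/u along it. *)
Lemma large_col_prob_le j (u : R) : 0 < u ->
  (P (A @^-1` large_col j u) <= (2 * K / u)%:E)%E.
Proof.
move=> u0; apply: (@prob_preimage_le _ _ j); first exact: measurable_large_col.
  by rewrite divr_ge0 ?mulr_ge0 ?ltW.
move=> M; have [v vv orth] := unit_vector_orth_rows M j.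
have -> : 2 * K / u = K * (2 * u^-1) by ring.
apply: le_trans (slab1_prob_le j vv _); last by rewrite invr_ge0 ltW.
apply: le_prob; first by apply: measurable_setrow_preimage; exact: measurable_large_col.
  exact: measurable_slab.
move=> w /= lw; rewrite -[row j (A w)](row_set_row_eq j M).
by apply: (large_col_slab u0 lw vv) => k kj; rewrite row_set_row_neq// orth.
Qed.

(* Singularity has probability zero because it stays so when the rows of [A] are
   substituted one at a time into the identity matrix. *)
Definition replace_rows (k : nat) (M : 'M[R]_n) : 'M[R]_n :=
  \matrix_(i, l) if (i < k)%N then M i l else (i == l)%:R.

Lemma measurable_replace_rows k :
  measurable_fun setT (replace_rows k).
Proof.
apply: measurable_fun_mx => i l.
rewrite (_ : (fun _ => _) = fun M : 'M[R]_n => if (i < k)%N then M i l else (i == l)%:R).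
  by case: (i < k)%N => //; exact: measurable_mx_entry.
by apply/funext => w; rewrite mxE.
Qed.

Lemma replace_rows_prob_singular k : (k <= n)%N ->
  P [set w | replace_rows k (A w) \notin unitmx] = 0%E.
Proof.
have mns k' : measurable [set M | replace_rows k' M \notin unitmx].
  have := measurable_unitmx (@measurable_replace_rows k') => /measurableC.
  rewrite (_ : ~` _ = [set M | replace_rows k' M \notin unitmx])//.
  by apply/seteqP; split => M /= /negP.
have mA (C : set 'M[R]_n) : measurable C -> measurable (A @^-1` C).
  by move=> mC; rewrite -[X in measurable X]setTI; exact: measurable_funP.
elim: k => [_|k IH kn].
  rewrite (_ : [set w | _] = set0) ?measure0//; apply/seteqP; split => // w /=.
  rewrite (_ : replace_rows 0 _ = 1%:M) ?unitmx1//.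
  by apply/matrixP => i l; rewrite !mxE ltn0.
(* Row k is the only row in which [replace_rows k] and [replace_rows k.+1] differ; [C] is the event
   that this substitution creates singularity. *)
pose j := Ordinal kn.
pose C := [set M | replace_rows k.+1 M \notin unitmx] `&`
  ~` [set M | replace_rows k M \notin unitmx].
have mC : measurable C by apply: measurableI => //; exact: measurableC.
have PC : (P (A @^-1` C) <= 0%:E)%E.
  apply: (@prob_preimage_le _ _ j) => // M.
  have [v vv orth] := unit_vector_orth_rows (replace_rows k.+1 M) j.
  have := slab1_prob_le j vv (lexx 0); rewrite !mulr0; apply: le_trans.
  apply: le_prob; first exact: measurable_setrow_preimage.
    exact: measurable_slab.
  move=> w [/= sing1 /negP]; rewrite negbK => unit0.
  (* If the new row j is not orthogonal to [v], pairing a left kernel vector [z] of the new matrix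
     with [v] gives z_j = 0, so [z] also kills the old matrix. Hence [C] lies in a slab of width
     zero. *)
  rewrite normr_le0; apply: contraTT unit0 => h0.
  set M' := set_row j M (row j (A w)) in sing1 *.
  rewrite -row_free_unit -kermx_eq0; move: sing1.
  rewrite -row_free_unit -kermx_eq0 => /rowV0Pn [z /sub_kermxP zM z0].
  have rows1 i : row i (replace_rows k.+1 M') =
      if i == j then row j (A w) else row i (replace_rows k.+1 M).
    apply/rowP => l; case: eqP => [->|/eqP ij]; rewrite !mxE ?ltnSn ?eqxx ?mxE//.
    by rewrite (negPf ij).
  have zj : z 0 j = 0.
    have /(congr1 (fun x => dotr x v)) := zM.
    rewrite dotrE (mulmx_sum_row z) mulmx_suml summxE (bigD1 j)//= big1; last first.
      move=> i ij; rewrite rows1 (negPf ij) -scalemxAl mxE.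
      by have := orth i ij; rewrite dotrE => ->; rewrite mulr0.
    rewrite rows1 eqxx addr0 -scalemxAl mxE -dotrE /dotr [RHS]big1.
      by move=> /eqP; rewrite mulf_eq0 (negPf h0) orbF => /eqP.
    by move=> i _; rewrite mxE mul0r.
  apply/rowV0Pn; exists z => //; apply/sub_kermxP; rewrite -zM.
  apply/rowP => l; rewrite !mxE; apply: eq_bigr => i _.
  have [->|ij] := eqVneq i j; first by rewrite zj !mul0r.
  rewrite !mxE [in RHS]ltnS [in RHS]leq_eqVlt (_ : (i == k :> nat) = false)//.
  by apply: contra_neqF ij => /eqP ik; exact: ord_inj.
apply/eqP; rewrite eq_le measure_ge0 andbT.
apply: (@le_trans _ _ (P (A @^-1` C `|` A @^-1` [set M | replace_rows k M \notin unitmx]))).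
  apply: le_prob; first exact: (mA _ (mns k.+1)).
    by apply: measurableU; [exact: (mA _ mC)|exact: (mA _ (mns k))].
  move=> w /= s1.
  have [s0|s0] := boolP (replace_rows k (A w) \notin unitmx); [by right|left; split => //].
  by rewrite /=; exact/negP.
apply: (le_trans (measureU2 _ (mA _ mC) (mA _ (mns k)))).
by rewrite [X in (_ + X)%E]IH ?(ltnW kn)// adde0.
Qed.

Lemma prob_singular : P [set w | A w \notin unitmx] = 0%E.
Proof.
rewrite -(replace_rows_prob_singular (leqnn n)); congr (P _); apply/seteqP; split => w /=;
  by rewrite (_ : replace_rows n _ = A w)//; apply/matrixP => i l; rewrite mxE ltn_ord.
Qed.

End small_ball.

(** Sum 2 a_i a_k <= a_i^2 + a_k^2 over all pairs in [J]. *)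
Lemma sqr_sum_le (R : realDomainType) (I : finType) (J : {set I}) (a : I -> R) :
  (\sum_(i in J) a i) ^+ 2 <= #|J|%:R * \sum_(i in J) a i ^+ 2.
Proof.
have -> : (\sum_(i in J) a i) ^+ 2 = \sum_(i in J) \sum_(k in J) a i * a k.
  by rewrite expr2 mulr_suml; apply: eq_bigr => i _; rewrite mulr_sumr.
rewrite -(ler_pM2l (ltr0n _ 2)).
have -> : 2 * (#|J|%:R * \sum_(i in J) a i ^+ 2) =
    \sum_(i in J) \sum_(k in J) (a i ^+ 2 + a k ^+ 2) :> R.
  under [RHS]eq_bigr do rewrite big_split.
  rewrite big_split /= sumr_const -[X in _ = _ + X]mulr_natl.
  under [X in _ = X + _]eq_bigr do rewrite sumr_const -mulr_natl.
  by rewrite -mulr_sumr; ring.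
rewrite mulr_sumr; apply: ler_sum => i _; rewrite mulr_sumr; apply: ler_sum => k _.
by have := sqr_ge0 (a i - a k); nra.
Qed.

Section residual_norm.
Variables (R : realType) (n : nat) (J : {set 'I_n}).

(* Zero on the null event where the rows outside [J] are dependent. *)
Definition residual_norm2 i (M : 'M[R]_n) : R :=
  if outer_gram J M \in unitmx
  then dotr (row i M *m residual J M) (row i M *m residual J M) else 0.

Lemma residual_norm2_ge0 i M : 0 <= residual_norm2 i M.
Proof. by rewrite /residual_norm2; case: ifP; rewrite ?dotr_ge0. Qed.

Lemma residual_set_row i (M : 'M[R]_n) x : i \in J ->
  residual J (set_row i M x) = residual J M.
Proof. by move=> iJ; rewrite /residual /outer_gram outer_rows_set_row. Qed.

Lemma outer_gram_set_row i (M : 'M[R]_n) x : i \in J ->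
  outer_gram J (set_row i M x) = outer_gram J M.
Proof. by move=> iJ; rewrite /outer_gram outer_rows_set_row. Qed.

Lemma measurable_outer_rows : measurable_fun setT (fun M : 'M[R]_n => outer_rows J M).
Proof.
apply: measurable_fun_mx => i k.
rewrite (_ : (fun _ => _) = fun M : 'M[R]_n => if i \in J then 0 else M i k).
  by case: (i \in J) => //; exact: measurable_mx_entry.
by apply/funext => M; rewrite mxE.
Qed.

Lemma measurable_outer_gram : measurable_fun setT (fun M : 'M[R]_n => outer_gram J M).
Proof.
apply: measurable_addmx => //; apply: measurable_mulmx; last apply: measurable_trmx;
  exact: measurable_outer_rows.
Qed.

Lemma measurable_residual : measurable_fun setT (fun M : 'M[R]_n => residual J M).
Proof.
apply: measurable_addmx => //; apply: measurable_oppmx.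
apply: measurable_mulmx; last exact: measurable_outer_rows.
apply: measurable_mulmx; first by apply: measurable_trmx; exact: measurable_outer_rows.
by apply: measurable_invmx; exact: measurable_outer_gram.
Qed.

Lemma measurable_residual_norm2 i : measurable_fun setT (residual_norm2 i).
Proof.
apply: measurable_fun_ifT => //.
  apply: (measurable_fun_bool true); rewrite setTI.
  by apply: measurable_unitmx; exact: measurable_outer_gram.
have mr : measurable_fun setT (fun M : 'M[R]_n => row i M *m residual J M).
  by apply: measurable_mulmx; [exact: measurable_row|exact: measurable_residual].
by apply: measurable_sum => k; apply: measurable_funM; exact: measurable_entry.
Qed.

End residual_norm.

(** * One large column against three small ones *)

Section joint_small_ball.
Context d (T : measurableType d) (R : realType) (P : probability T R).
Context (n : nat) (A : {RV P >-> 'M[R]_n}) (K : R).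
Hypothesis indA : mutually_independent P (fun (i : 'I_n) w => row i (A w)).
Hypothesis isoA : forall i, isotropic P (fun w => row i (A w)).
Hypothesis K_gt0 : 0 < K.
Hypothesis dens1 : forall i, proj_density_bounded P 1 K (fun w => row i (A w)).
Hypothesis dens4 : forall i, proj_density_bounded P 4 K (fun w => row i (A w)).

(** The residual projection does not involve row i, so after resampling that row isotropy yields the
    squared Hilbert-Schmidt norm of the projection, which is |J|. *)
Lemma residual_norm2_mean (J : {set 'I_n}) i : i \in J ->
  (\int[P]_w (residual_norm2 J i (A w))%:E <= #|J|%:R%:E)%E.
Proof.
move=> iJ; have mr := @measurable_residual_norm2 R n J i.
rewrite (resample_integral indA i (g := EFin \o residual_norm2 J i)); last 2 first.
- exact/measurable_EFinP.
- by move=> M; rewrite lee_fin residual_norm2_ge0.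
(* The value of the inner integral over the resampled row. *)
pose c (M : 'M[R]_n) : R := if outer_gram J M \in unitmx then #|J|%:R else 0.
rewrite (eq_integral (fun w => (c (A w))%:E)); last first.
  move=> w' _ /=; rewrite /c /residual_norm2.
  under eq_integral do rewrite outer_gram_set_row// residual_set_row// row_set_row_eq.
  case: ifP => Gu; last by rewrite integral0.
  by rewrite isotropic_second_moment ?residual_trace//; apply: measurable_row.
apply: (@le_trans _ _ (\int[P]_w (#|J|%:R%:E))%E).
  apply: ge0_le_integral => //.
  - by move=> w _; rewrite lee_fin /c; case: ifP.
  - apply/measurable_EFinP; apply: measurable_fun_ifT => //.
    apply: (measurable_fun_bool true); rewrite setTI; apply: measurable_unitmx.
    exact: measurableT_comp (@measurable_outer_gram _ _ _) _.
  - by move=> w _; rewrite lee_fin /c; case: ifP.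
by rewrite integral_cst//= probability_setT mule1.
Qed.

Definition dominant_col j (J : {set 'I_n}) (q tau : R) : set 'M[R]_n :=
  large_col j (q * tau) `&` [set N | forall i, i \in J -> inv_dist2 N i <= tau ^+ 2].

Lemma measurable_dominant_col j J q tau : measurable (dominant_col j J q tau).
Proof.
apply: measurableI; first exact: measurable_large_col.
apply: measurable_forall_fin => i; case: (i \in J).
  rewrite (_ : (fun _ => _) = [set N | inv_dist2 N i <= tau ^+ 2]).
    by apply: measurable_le_set => //; exact: (@measurable_inv_dist2 _ _ _ _ id).
  by apply/seteqP; split => N /= => [/(_ isT)|].
by rewrite (_ : (fun _ => _) = setT)//; apply/seteqP; split.
Qed.

(** With a = s / q, the four-dimensional bound is 2 K / (q tau) times (2 a)^3 and the
    one-dimensional bound is 2 K / (q tau). Their minimum is at most 2 K / (q tau) times (2 a)^2,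
    and s^2 is at most three times the sum of the squared residual norms; hence 24 = 2 * 4 * 3. *)
Lemma dominant_col_slice j (J : {set 'I_n}) (q tau : R) (M : 'M[R]_n) :
    0 < q -> 0 < tau -> j \notin J -> #|J| = 3%N ->
  (P [set w | dominant_col j J q tau (set_row j M (row j (A w)))] <=
   (24 * K / (q ^+ 3 * tau) * \sum_(i in J) residual_norm2 (j |: J) i M)%:E)%E.
Proof.
move=> q0 t0 jJ J3; set J' := j |: J.
have J'4 : #|J'| = 4%N by rewrite cardsU1 jJ J3.
have jJ' : j \in J' by rewrite setU11.
have mdom : measurable [set w | dominant_col j J q tau (set_row j M (row j (A w)))].
  by apply: measurable_setrow_preimage; exact: measurable_dominant_col.
(* The Gram matrix does not see row j, so if it is singular no choice of row j gives an invertible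
   matrix and the event is empty. *)
have [Gu|Gnu] := boolP (outer_gram J' M \in unitmx); last first.
  rewrite (_ : [set w | _] = set0).
    rewrite measure0 lee_fin; apply: mulr_ge0.
      by rewrite divr_ge0 ?mulr_ge0 ?exprn_ge0 ?ltW.
    by apply: sumr_ge0 => i _; exact: residual_norm2_ge0.
  apply/seteqP; split => // w [[Nu _] _]; move: Gnu.
  by rewrite -(outer_gram_set_row M (row j (A w)) jJ') outer_gram_unit.
have [v vv vorth] := unit_vector_orth_rows M j.
have Wv : outer_rows J' M *m v^T = 0.
  by apply: outer_rows_orth => k; rewrite !inE negb_or => /andP[kj _]; exact: vorth.
(* The rows outside [J'] have rank at most n - 4, which leaves room for three directions besides
   [v]. *)
have [|U [UU WU Umax]] := orthonormal_completion (k := 3) vv Wv.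
  have n4 : (4 <= n)%N by rewrite -J'4 -[X in (_ <= X)%N]card_ord max_card.
  by have := rank_outer_rows J' M; rewrite J'4; lia.
pose s := \sum_(i in J) Num.sqrt (residual_norm2 J' i M).
have s0 : 0 <= s by apply: sumr_ge0 => i _; exact: sqrtr_ge0.
have Uk_orth k : outer_rows J' M *m (row k U)^T = 0.
  apply/colP => l; have /(congr1 (fun B : 'M[R]_(n, 4) => B l k)) := WU.
  rewrite [LHS]mxE [RHS]mxE => W0; rewrite [LHS]mxE [RHS]mxE -[RHS]W0.
  by apply: eq_bigr => i _; congr (_ * _); rewrite !mxE.
have UUkl k l : dotr (row k U) (row l U) = (k == l)%:R.
  have /(congr1 (fun B : 'M[R]_4 => B k l)) := UU; rewrite [LHS]mxE [RHS]mxE => <-.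
  by apply: eq_bigr => i _; rewrite !mxE.
(* The last direction is [v], with the short side given by [large_col_slab]; the other three sides
   come from [dotr_row_le]. *)
pose e (k : 'I_4) := if k == ord_max then (q * tau)^-1 else q^-1 * s.
have e0 k : 0 <= e k.
  by rewrite /e; case: ifP => _; rewrite ?invr_ge0 ?mulr_ge0 ?invr_ge0 ?(ltW q0) ?(ltW t0).
have slab w : dominant_col j J q tau (set_row j M (row j (A w))) ->
    forall k, `|dotr (row j (A w)) (row k U)| <= e k.
  set N := set_row _ _ _ => -[[Nu rj] rJ] k.
  have vorthN l : l != j -> dotr (row l N) v = 0.
    by move=> lj; rewrite row_set_row_neq// vorth.
  rewrite -[row j (A w)](row_set_row_eq j M) -/N /e; case: eqP => [->|/eqP kmax].
    by rewrite Umax; apply: large_col_slab => //; exact: mulr_gt0.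
  have qt0 : 0 < q * tau by rewrite mulr_gt0.
  apply: le_trans (dotr_row_le Nu jJ q0 t0 rj rJ vv vorthN _ _) _.
  - by rewrite -Umax UUkl (negPf kmax).
  - move=> l lj lJ; rewrite row_set_row_neq//.
    by apply: (outer_rows_orthP (Uk_orth k)); rewrite !inE negb_or lj.
  rewrite ler_wpM2l ?invr_ge0 ?(ltW q0)//; apply: ler_sum => i iJ.
  rewrite row_set_row_neq; last by apply: contraNneq jJ => <-.
  rewrite /residual_norm2 Gu; apply: dotr_le_residual => //.
  by rewrite UUkl eqxx.
have mslab : measurable [set w | forall k, (`|dotr (row j (A w)) (row k U)| <= e k)%R].
  by apply: measurable_forall_fin => k; exact: measurable_slab.
have le4 := slab_prob_le (ltW K_gt0) e0 (dens4 j) UU.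
have le1 := slab1_prob_le K_gt0 dens1 j vv (e0 ord_max).
set a := q^-1 * s in e e0 slab mslab le4 le1 *.
have a0 : 0 <= a by rewrite mulr_ge0 ?invr_ge0 ?(ltW q0).
apply: (@le_trans _ _ (K * (2 * (q * tau)^-1) * (2 * a) ^+ 2)%:E); last first.
  rewrite lee_fin.
  have -> : K * (2 * (q * tau)^-1) * (2 * a) ^+ 2 = 8 * K / (q ^+ 3 * tau) * s ^+ 2.
    by rewrite /a; field; rewrite !gt_eqF.
  have -> : 24 * K / (q ^+ 3 * tau) = 8 * K / (q ^+ 3 * tau) * 3 by ring.
  rewrite -[X in _ <= X]mulrA ler_wpM2l//; first by rewrite divr_ge0 ?mulr_ge0 ?exprn_ge0 ?ltW.
  have := sqr_sum_le J (fun i => Num.sqrt (residual_norm2 J' i M)).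
  rewrite -/s J3; under [in X in X -> _]eq_bigr do rewrite sqr_sqrtr ?residual_norm2_ge0//.
  by [].
have c0 : 0 <= K * (2 * (q * tau)^-1).
  by rewrite mulr_ge0 ?mulr_ge0 ?invr_ge0 ?mulr_ge0 ?ltW.
(* min(1, x^3) <= x^2: only second moments of the projected rows are available. *)
have [a1|a1] := leP (2 * a) 1.
  apply: (le_trans (le_prob P mdom mslab slab)); apply: (le_trans le4).
  rewrite lee_fin (bigD1 ord_max)//= {1}/e eqxx mulrA ler_wpM2l//.
  rewrite (eq_bigr (fun _ => 2 * a)); last by move=> k /negPf kmax; rewrite /e kmax.
  rewrite prodr_const (_ : #|_| = 3%N); last by rewrite cardC1 card_ord.
  by apply: ler_wiXn2l => //; rewrite mulr_ge0.
apply: (@le_trans _ _ (K * (2 * (q * tau)^-1))%:E).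
  apply: le_trans le1; rewrite {1}/e eqxx.
  apply: le_prob => //; first exact: measurable_slab.
  by move=> w /slab /(_ ord_max); rewrite Umax /e eqxx.
rewrite lee_fin ler_peMr// exprn_ege1//.
exact: ltW.
Qed.

Lemma dominant_col_prob_le j (J : {set 'I_n}) (q tau : R) :
    0 < q -> 0 < tau -> j \notin J -> #|J| = 3%N ->
  (P (A @^-1` dominant_col j J q tau) <= (288 * K / (q ^+ 3 * tau))%:E)%E.
Proof.
move=> q0 t0 jJ J3; set c := 24 * K / (q ^+ 3 * tau).
have c0 : 0 <= c by rewrite divr_ge0 ?mulr_ge0 ?exprn_ge0 ?ltW.
have mr i : measurable_fun setT (fun w => residual_norm2 (j |: J) i (A w)).
  by apply: measurableT_comp => //; exact: measurable_residual_norm2.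
pose g i (M : 'M[R]_n) := residual_norm2 (j |: J) i M.
have sumJ M : \sum_(i in J) residual_norm2 (j |: J) i M = \sum_(i <- enum J) g i M.
  by rewrite big_enum.
have slice M := dominant_col_slice M q0 t0 jJ J3.
apply: (le_trans (resample_prob_le indA (measurable_dominant_col j J q tau) _ slice)).
  apply/measurable_EFinP; apply: measurable_funM => //.
  under eq_fun do rewrite sumJ; apply: measurable_sum => i.
  exact: measurable_residual_norm2.
under eq_integral do rewrite sumJ EFinM -sumEFin.
rewrite ge0_integralZl//; last 2 first.
- by apply: emeasurable_sum => i; exact/measurable_EFinP.
- by move=> w _; apply: sume_ge0 => i _; rewrite lee_fin residual_norm2_ge0.
rewrite ge0_integral_sum//; last 2 first.
- by move=> i; exact/measurable_EFinP.
- by move=> i w _; rewrite lee_fin residual_norm2_ge0.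
(* Each of the three residual norms has mean at most 4, the cardinal of [j |: J]. *)
have -> : 288 * K / (q ^+ 3 * tau) = c * \sum_(i <- enum J) 4.
  by rewrite big_enum sumr_const J3 /c; ring.
rewrite [X in (_ <= X)%E]EFinM lee_wpmul2l// -sumEFin big_enum [X in (_ <= X)%E]big_enum /=.
apply: lee_sum => i iJ; have iJ' : i \in j |: J by rewrite !inE iJ orbT.
by rewrite (le_trans (residual_norm2_mean iJ'))// cardsU1 jJ J3.
Qed.

End joint_small_ball.

(** * Summing the small ball estimates *)

(** Integrate the pointwise inequality between c times the indicator of [B] and the weighted sum of
    indicators. *)
Lemma weighted_markov d (T : measurableType d) (R : realType) (P : probability T R)
    (I : finType) (wt p : I -> R) (E : I -> set T) (B : set T) (c : R) :
  0 < c -> (forall i, 0 <= wt i) -> (forall i, measurable (E i)) -> measurable B ->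
  (forall x, B x -> c <= \sum_i wt i * \1_(E i) x) ->
  (forall i, (P (E i) <= (p i)%:E)%E) ->
  (P B <= (c^-1 * \sum_i wt i * p i)%:E)%E.
Proof.
move=> c0 wt0 mE mB BE PE.
have mI i : measurable_fun setT (fun x => (wt i * \1_(E i) x)%:E).
  by apply/measurable_EFinP; apply: measurable_funM => //; exact: measurable_indic.
have I0 i x : (0 <= (wt i * \1_(E i) x)%:E)%E by rewrite lee_fin mulr_ge0.
have : (c%:E * P B <= (\sum_i wt i * p i)%:E)%E.
  rewrite -[B]setIT -integral_indic// -ge0_integralZl//; last 2 first.
  - by apply/measurable_EFinP; exact: measurable_indic.
  - by rewrite lee_fin ltW.
  apply: (@le_trans _ _ (\int[P]_x (\sum_i (wt i * \1_(E i) x)%:E))%E).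
    apply: ge0_le_integral => //.
    - by move=> x _; rewrite mule_ge0 ?lee_fin ?(ltW c0).
    - by apply: measurable_funeM; apply/measurable_EFinP; exact: measurable_indic.
    - by apply: emeasurable_sum => i.
    - move=> x _; rewrite sumEFin -EFinM lee_fin indicE.
      have [|_] := boolP (x \in B); first by rewrite inE mulr1 => /BE.
      by rewrite mulr0; apply: sumr_ge0 => i _; rewrite -lee_fin.
  rewrite ge0_integral_sum// -sumEFin; apply: lee_sum => i _.
  under eq_integral do rewrite EFinM.
  rewrite ge0_integralZl//; last 2 first.
  - by apply/measurable_EFinP; exact: measurable_indic.
  - by rewrite lee_fin.
  rewrite integral_indic// setIT EFinM lee_wpmul2l ?lee_fin//; exact: PE.
have -> : (c^-1 * \sum_i wt i * p i)%:E = (c^-1%:E * (\sum_i wt i * p i)%:E)%E by [].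
by rewrite lee_pdivlMl.
Qed.

(** The largest k with 4^k a <= x suffices by itself, since x < 4 a 4^k. *)
Lemma dyadic_layers (R : realFieldType) (x a : R) m : 0 <= a ->
  a <= x -> x < 4 ^+ m * a ->
  x <= 4 * a * \sum_(k < m) 4 ^+ k * (4 ^+ k * a <= x)%R%:R.
Proof.
move=> a0 ax; elim: m => [|m IH xm].
  by rewrite expr0 mul1r ltNge ax.
rewrite big_ord_recr /=; have [le_x|/IH] := leP (4 ^+ m * a) x.
  rewrite mulr1 mulrDr -[x in x <= _]add0r lerD//.
    by rewrite !mulr_ge0// sumr_ge0// => k _; rewrite mulr_ge0// exprn_ge0.
  by rewrite mulrAC -exprS ltW.
by rewrite mulr0 addr0.
Qed.

(** Factor by factor, n - i <= 4 (s - i) for i < 3. Here [s] will count the small columns. *)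
Lemma bin3_half n s : (8 <= n)%N -> (n < s.*2)%N -> ('C(n, 3) <= 64 * 'C(s, 3))%N.
Proof.
move=> n8 ns; rewrite -(leq_pmul2r (fact_gt0 3)) -mulnA !bin_ffact.
rewrite !ffactnS !ffactn0 !muln1.
have -> : (64 * (s * (s.-1 * s.-1.-1)) = (4 * s) * ((4 * s.-1) * (4 * s.-1.-1)))%N by ring.
by apply: leq_mul; [lia|apply: leq_mul; lia].
Qed.

Lemma geometric_half_le (R : realFieldType) n :
  \sum_(k < n) (2^-1 : R) ^+ k <= 2.
Proof.
have -> : \sum_(k < n) (2^-1 : R) ^+ k = 2 - 2 * 2^-1 ^+ n.
  elim: n => [|n IH]; first by rewrite big_ord0 expr0 mulr1 subrr.
  by rewrite big_ord_recr /= IH exprS; field.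
by rewrite gerBl mulr_ge0// exprn_ge0.
Qed.

Section tail.
Context d (T : measurableType d) (R : realType) (P : probability T R).
Context (n : nat) (A : {RV P >-> 'M[R]_n}) (K : R).
Hypothesis n_ge8 : (8 <= n)%N.
Hypothesis indA : mutually_independent P (fun (i : 'I_n) w => row i (A w)).
Hypothesis isoA : forall i, isotropic P (fun w => row i (A w)).
Hypothesis K_gt0 : 0 < K.
Hypothesis dens1 : forall i, proj_density_bounded P 1 K (fun w => row i (A w)).
Hypothesis dens4 : forall i, proj_density_bounded P 4 K (fun w => row i (A w)).
Variable tau : R.
Hypothesis tau_gt0 : 0 < tau.

Let n_gt0 : 0 < n%:R :> R.
Proof. by rewrite ltr0n; lia. Qed.

Let measurable_preim (C : set 'M[R]_n) : measurable C -> measurable (A @^-1` C).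
Proof. by move=> mC; rewrite -[X in measurable X]setTI; exact: measurable_funP. Qed.

Lemma large_col_indic j u w : A w \in unitmx ->
  \1_(A @^-1` large_col j u) w = (u ^+ 2 <= inv_dist2 (A w) j)%R%:R :> R.
Proof.
move=> Aw; rewrite indicE; congr (nat_of_bool _)%:R.
by apply/idP/idP => [|ru]; rewrite inE => //; case.
Qed.

Definition many_large : set T :=
  [set w | A w \in unitmx /\ n%:R / 2 <= \sum_j \1_(A @^-1` large_col j tau) w :> R].

Lemma measurable_many_large : measurable many_large.
Proof.
apply: measurableI; first exact: measurable_unitmx.
apply: measurable_le_set => //; apply: measurable_sum => j.
by apply: measurable_indic; apply: measurable_preim; exact: measurable_large_col.
Qed.

Lemma many_large_prob_le : (P many_large <= (4 * K / tau)%:E)%E.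
Proof.
have := @weighted_markov _ _ _ P _ (fun _ : 'I_n => 1) (fun _ => 2 * K / tau)
  (fun j => A @^-1` large_col j tau) many_large (n%:R / 2).
have -> : (n%:R / 2)^-1 * (\sum_(i : 'I_n) 1 * (2 * K / tau)) = 4 * K / tau.
  by rewrite sumr_const card_ord -mulr_natl; field; rewrite !gt_eqF.
apply => //; [by rewrite divr_gt0| | | |].
- by move=> j; apply: measurable_preim; exact: measurable_large_col.
- exact: measurable_many_large.
- by move=> w [_]; under [in X in _ -> X]eq_bigr do rewrite mul1r.
- by move=> j; exact: large_col_prob_le.
Qed.

(** Some |b_j| reaches 2^n tau. Off this event [n] dyadic layers suffice, and its probability is
    harmless because n <= 2^n. *)
Definition huge_col : set T :=
  [set w | 1 <= \sum_j \1_(A @^-1` large_col j (2 ^+ n * tau)) w :> R].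

Lemma measurable_huge_col : measurable huge_col.
Proof.
apply: measurable_le_set => //; apply: measurable_sum => j.
by apply: measurable_indic; apply: measurable_preim; exact: measurable_large_col.
Qed.

Lemma huge_col_prob_le : (P huge_col <= (2 * K / tau)%:E)%E.
Proof.
have := @weighted_markov _ _ _ P _ (fun _ : 'I_n => 1) (fun _ => 2 * K / (2 ^+ n * tau))
  (fun j => A @^-1` large_col j (2 ^+ n * tau)) huge_col 1.
have mE j : measurable (A @^-1` large_col j (2 ^+ n * tau)).
  by apply: measurable_preim; exact: measurable_large_col.
move=> /(_ ltr01 (fun _ => ler01) mE measurable_huge_col) H.
apply: le_trans (H _ _) _.
- by move=> w; under [in X in _ -> X]eq_bigr do rewrite mul1r.
- by move=> j; apply: large_col_prob_le => //; rewrite mulr_gt0// exprn_gt0.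
rewrite lee_fin invr1 mul1r sumr_const card_ord mul1r -[X in X <= _]mulr_natl.
have -> : n%:R * (2 * K / (2 ^+ n * tau)) = n%:R / 2 ^+ n * (2 * K / tau).
  by field; rewrite !gt_eqF ?exprn_gt0.
rewrite ler_piMl//; first by rewrite divr_ge0 ?mulr_ge0 ?ltW.
by rewrite ler_pdivrMr ?exprn_gt0// mul1r -natrX ler_nat ltnW// ltn_expl.
Qed.

(** The triples are (j, J, k). Invalid ones get weight zero, so sums can run over the whole product
    type. *)
Let valid (p : 'I_n * {set 'I_n} * 'I_n) := (p.1.1 \notin p.1.2) && (#|p.1.2| == 3)%N.
Let wt p : R := if valid p then 4 ^+ p.2 else 0.
Let dom (p : 'I_n * {set 'I_n} * 'I_n) : set 'M[R]_n :=
  dominant_col p.1.1 p.1.2 (2 ^+ p.2) tau.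

(** Every large column j, with every three-element set [J] of small columns, contributes 4^k for
    each layer k that it reaches. There are at least C(n,3) / 64 such sets, and the layer sums [f]
    over the large columns total at least 3 n / 4; the product is the constant 3 / 256. *)
Lemma dominant_count (M : 'M[R]_n) : M \in unitmx ->
    \sum_j ((tau ^+ 2 <= inv_dist2 M j)%R%:R : R) < n%:R / 2 ->
    (forall j, inv_dist2 M j < 4 ^+ n * tau ^+ 2) ->
    4 * tau ^+ 2 * n%:R <= \sum_j inv_dist2 M j ->
  3 / 256 * n%:R * 'C(n, 3)%:R <= \sum_p wt p * \1_(dom p) M.
Proof.
move=> Mu few small big; set r := inv_dist2 M.
pose L := [set j | tau ^+ 2 <= r j]%SET.
have cardL : (#|L|.*2 < n)%N.
  rewrite -(ltr_nat R) -mul2n natrM mulrC -ltr_pdivlMr//; apply: le_lt_trans few.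
  rewrite -sum1_card natr_sum big_mkcond; apply: ler_sum => j _.
  by rewrite inE; case: ifP.
pose D := [set J : {set 'I_n} | (J \subset ~: L) && (#|J| == 3%N)]%SET.
have cardD : 'C(n, 3)%:R <= 64 * #|D|%:R :> R.
  rewrite -natrM ler_nat cards_draws bin3_half//.
  have := cardsC L; rewrite card_ord. move: cardL; set a := #|L|; set b := #|~: L|; lia.
have t2 : 0 < tau ^+ 2 by rewrite exprn_gt0.
pose f j : R := \sum_(k < n) 4 ^+ k * (4 ^+ k * tau ^+ 2 <= r j)%R%:R.
have f0 j : 0 <= f j by apply: sumr_ge0 => k _; rewrite mulr_ge0 ?exprn_ge0.
(* Small columns account for at most n tau^2 of the total 4 n tau^2; the remaining 3 n tau^2 is
   compared with [f] through [dyadic_layers]. *)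
have sumL : 3 / 4 * n%:R <= \sum_(j in L) f j.
  rewrite -(ler_pM2l (mulr_gt0 (ltr0n _ 4) t2)) mulr_sumr.
  have : \sum_(j in L) r j <= \sum_(j in L) 4 * tau ^+ 2 * f j.
    apply: ler_sum => j; rewrite inE => jL; apply: dyadic_layers => //; exact: ltW.
  have : \sum_(j in ~: L) r j <= n%:R * tau ^+ 2.
    apply: (@le_trans _ _ (\sum_(j in ~: L) tau ^+ 2)).
      by apply: ler_sum => j; rewrite !inE -ltNge => /ltW.
    rewrite sumr_const -[X in X <= _]mulr_natl ler_wpM2r ?(ltW t2)// ler_nat.
    by rewrite -[X in (_ <= X)%N]card_ord max_card.
  move: big; rewrite (bigID (mem L))/= -/r.
  rewrite [X in _ + X](eq_bigl (fun j => j \in ~: L)) => [|j]; last by rewrite !inE.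
  by set a := \sum_(j in L) r j; set b := \sum_(j in ~: L) r j; lra.
apply: (@le_trans _ _ (#|D|%:R * \sum_(j in L) f j)).
  apply: (@le_trans _ _ (#|D|%:R * (3 / 4 * n%:R))); last by rewrite ler_wpM2l.
  have := ltW n_gt0; set a := n%:R; set b := #|D|%:R in cardD *; set c := _%:R in cardD *.
  by move=> a0; nra.
rewrite -(pair_bigA _ (fun q k => wt (q, k) * \1_(dom (q, k)) M))/=.
rewrite -(pair_bigA _ (fun j J => \sum_k wt (j, J, k) * \1_(dom (j, J, k)) M))/=.
have term0 j J k : 0 <= wt (j, J, k) * \1_(dom (j, J, k)) M.
  by rewrite mulr_ge0// /wt; case: ifP => // _; rewrite exprn_ge0.
rewrite mulr_sumr big_mkcond; apply: ler_sum => j _.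
case: ifP => jL; last by apply: sumr_ge0 => J _; apply: sumr_ge0.
rewrite mulr_natl -sumr_const big_mkcond; apply: ler_sum => J _.
case: ifP => JD; last by apply: sumr_ge0.
move: JD; rewrite inE => /andP[JL J3].
have jJ : j \notin J.
  by apply/negP => /(fintype.subsetP JL); rewrite inE jL.
apply: ler_sum => k _; rewrite /wt /valid /= jJ J3 /= ler_wpM2l ?exprn_ge0//.
have [kr|_] := boolP (4 ^+ k * tau ^+ 2 <= r j)%R => //.
rewrite indicE mem_set//; split => /=.
  split => //=; rewrite exprMn -exprM mulnC exprM (_ : 2 ^+ 2 = 4 :> R)//.
  by ring.
move=> i /(fintype.subsetP JL); rewrite !inE -ltNge => /ltW; exact.
Qed.

Definition dominated : set T :=
  [set w | A w \in unitmx] `&`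
  [set w | 4 * tau ^+ 2 * n%:R <= \sum_j inv_dist2 (A w) j] `&`
  ~` many_large `&` ~` huge_col.

Lemma measurable_sum_inv_dist2 (c : R) :
  measurable [set w | c <= \sum_j inv_dist2 (A w) j].
Proof.
apply: measurable_le_set => //; apply: measurable_sum => j.
exact: measurable_inv_dist2.
Qed.

Lemma measurable_dominated : measurable dominated.
Proof.
apply: measurableI; last by apply: measurableC; exact: measurable_huge_col.
apply: measurableI; last by apply: measurableC; exact: measurable_many_large.
apply: measurableI; last exact: measurable_sum_inv_dist2.
exact: measurable_unitmx.
Qed.

Lemma dominated_prob_le : (P dominated <= (256 * 192 * K / tau)%:E)%E.
Proof.
pose c : R := 3 / 256 * n%:R * 'C(n, 3)%:R.
have bin_gt0 : 0 < 'C(n, 3)%:R :> R by rewrite ltr0n bin_gt0; lia.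
have c0 : 0 < c by rewrite !mulr_gt0 ?invr_gt0.
(* For invalid triples the trivial bound 1 is enough, their weight being zero. *)
pose pr p := if valid p then 288 * K / ((2 ^+ p.2) ^+ 3 * tau) else 1.
have wt0 p : 0 <= wt p by rewrite /wt; case: ifP => // _; rewrite exprn_ge0.
have mdom p : measurable (A @^-1` dom p).
  by apply: measurable_preim; exact: measurable_dominant_col.
apply: (le_trans (weighted_markov (p := pr) c0 wt0 mdom measurable_dominated _ _)).
- move=> w [[[Aw sumr] /not_andP[//|/negP few]] /negP huge].
  apply: (dominant_count Aw) => //.
    by move: few; rewrite -ltNge; under eq_bigr do rewrite large_col_indic//.
  move=> j; rewrite ltNge; apply: contra huge => huge.
  have ind1 : \1_(A @^-1` large_col j (2 ^+ n * tau)) w = 1 :> R.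
    rewrite large_col_indic// exprMn -exprM mulnC exprM (_ : 2 ^+ 2 = 4 :> R) ?huge//.
    by ring.
  by rewrite /huge_col /= (bigD1 j)//= ind1 lerDl sumr_ge0.
- move=> p; rewrite /pr; case: ifP => [/andP[jJ /eqP J3]|_].
    by apply: dominant_col_prob_le; rewrite ?exprn_gt0.
  exact: probability_le1.
rewrite lee_fin ler_pdivrMl//.
(* The weight 4^k against the decay 8^-k leaves 2^-k, so each pair (j, J) costs at most 576 K / tau.
   There are at most n C(n,3) pairs, and dividing by [c] gives 576 * 256 / 3 = 256 * 192. *)
have -> : \sum_p wt p * pr p =
    \sum_p (valid p)%:R * (288 * K / tau * 2^-1 ^+ (p.2 : 'I_n)).
  apply: eq_bigr => p _; rewrite /wt /pr; case: ifP => _; last by rewrite !mul0r.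
  rewrite mul1r exprVn -exprM mulnC exprM (_ : 2 ^+ 3 = 8 :> R); last by ring.
  rewrite (_ : 8 = 4 * 2 :> R) ?exprMn; last by ring.
  by field; rewrite !gt_eqF ?exprn_gt0.
rewrite -(pair_bigA _ (fun q (k : 'I_n) => (valid (q, k))%:R * (288 * K / tau * 2^-1 ^+ k)))/=.
apply: (@le_trans _ _ (\sum_(q : 'I_n * {set 'I_n}) (#|q.2| == 3%N)%:R * (576 * K / tau))).
  apply: ler_sum => q _.
  apply: (@le_trans _ _ (\sum_(k < n) (#|q.2| == 3%N)%:R * (288 * K / tau * 2^-1 ^+ k))).
    apply: ler_sum => k _; rewrite ler_wpM2r//.
      by rewrite !mulr_ge0 ?invr_ge0 ?exprn_ge0 ?(ltW K_gt0) ?(ltW tau_gt0).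
    by rewrite ler_nat /valid; case: (_ \notin _).
  rewrite -!mulr_sumr ler_wpM2l//.
  have -> : 576 * K / tau = 288 * K / tau * 2 by ring.
  by rewrite ler_wpM2l ?geometric_half_le// !mulr_ge0 ?invr_ge0 ?ltW.
rewrite -(pair_bigA _ (fun (j : 'I_n) (J : {set 'I_n}) => (#|J| == 3%N)%:R * (576 * K / tau)))/=.
rewrite sumr_const card_ord -mulr_natl -mulr_suml -natr_sum.
have -> : (\sum_(J : {set 'I_n}) (#|J| == 3) = 'C(n, 3))%N.
  rewrite -[n in RHS]card_ord -cardsT -cards_draws -sum1_card [RHS]big_mkcond /=.
  by apply: eq_bigr => J _; rewrite inE finset.subsetT /=; case: eqP.
by rewrite /c -subr_ge0 (_ : _ - _ = 0)//; field; rewrite gt_eqF.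
Qed.

(** The tail event is covered by the null singular event, [many_large], [huge_col] and [dominated],
    and 4 + 2 + 256 * 192 <= 256 * 200. *)
Lemma hsnorm_inv_tail :
  (P [set w | hsnorm_inv_ge (2 * tau * Num.sqrt n%:R) (A w)] <= (256 * 200 * K / tau)%:E)%E.
Proof.
pose sing := [set w | A w \notin unitmx].
have msing : measurable sing.
  rewrite (_ : sing = ~` [set w | A w \in unitmx]).
    by apply: measurableC; exact: measurable_unitmx.
  by apply/seteqP; split => w /= /negP.
have hs w : (2 * tau * Num.sqrt n%:R <= hsnorm (invmx (A w))) =
    (4 * tau ^+ 2 * n%:R <= \sum_j inv_dist2 (A w) j).
  have -> : hsnorm (invmx (A w)) = Num.sqrt (\sum_j inv_dist2 (A w) j).
    by rewrite /hsnorm exchange_big.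
  have -> : 2 * tau * Num.sqrt n%:R = Num.sqrt (4 * tau ^+ 2 * n%:R).
    have -> : 4 * tau ^+ 2 = (2 * tau) ^+ 2 by ring.
    by rewrite sqrtrM ?sqr_ge0// sqrtr_sqr ger0_norm// mulr_ge0 ?ltW.
  by rewrite ler_sqrt// sumr_ge0// => j _; exact: inv_dist2_ge0.
have mS : measurable [set w | hsnorm_inv_ge (2 * tau * Num.sqrt n%:R) (A w)].
  rewrite (_ : [set w | _] = sing `|` [set w | 4 * tau ^+ 2 * n%:R <= \sum_j inv_dist2 (A w) j]).
    by apply: measurableU => //; exact: measurable_sum_inv_dist2.
  apply/seteqP; split => w /=; rewrite /hsnorm_inv_ge /sing /= hs.
    by have [Aw /(_ isT)|_ _] := boolP (A w \in unitmx); [right|left].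
  by case=> [/negP|].
have m1 := measurable_many_large; have m2 := measurable_huge_col.
have m3 := measurable_dominated.
apply: (@le_trans _ _ (P (sing `|` (many_large `|` (huge_col `|` dominated))))).
  apply: le_prob => //; first by do 3 apply: measurableU => //.
  move=> w; rewrite /= /hsnorm_inv_ge /= hs.
  have [Aw /(_ isT) Sw|Aw _] := boolP (A w \in unitmx); last by left.
  right; have [|nm] := pselect (many_large w); [by left|right].
  by have [|nh] := pselect (huge_col w); [left|right].
apply: (le_trans (measureU2 _ msing _)); first by do 2 apply: measurableU => //.
rewrite [X in (X + _)%E](prob_singular indA K_gt0 dens1) add0e.
apply: (le_trans (measureU2 _ m1 _)); first by apply: measurableU.
have le_const : ((4 * K / tau)%:E + ((2 * K / tau)%:E + (256 * 192 * K / tau)%:E) <=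
    (256 * 200 * K / tau)%:E)%E.
  have Kt : 0 <= K / tau by rewrite divr_ge0 ?ltW.
  by rewrite -!EFinD lee_fin -!mulrA; move: (K / tau) Kt => x x0; nra.
apply: le_trans le_const.
apply: leeD; first exact: many_large_prob_le.
apply: (le_trans (measureU2 _ m2 m3)); apply: leeD; first exact: huge_col_prob_le.
exact: dominated_prob_le.
Qed.

End tail.

Theorem theorem1p1 (R : realType) :
  exists (n0 : nat) (C : R), 0 < C /\
  forall n : nat, (n0 <= n)%N ->
  forall (d : measure_display) (T : measurableType d) (P : probability T R)
    (A : {RV P >-> 'M[R]_n}) (K : R),
    mutually_independent P (fun (i : 'I_n) (w : T) => row i (A w)) ->
    (forall i : 'I_n, isotropic P (fun w => row i (A w))) ->
    0 < K ->
    (forall (i : 'I_n) (m : nat), m = 1%N \/ m = 4%N ->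
       proj_density_bounded P m K (fun w => row i (A w))) ->
  forall t : R, 0 < t ->
    (P [set w | hsnorm_inv_ge (t * Num.sqrt n%:R) (A w)] <= (C * K / t)%:E)%E.
Proof.
(* The threshold 8 is the one in [bin3_half]; taking tau = t / 2 doubles the constant 256 * 200. *)
exists 8, (256 * 400); split => // n n8 d T P A K indA isoA K0 dens t t0.
have t2 : 0 < t / 2 by rewrite divr_gt0.
have := hsnorm_inv_tail n8 indA isoA K0 (fun i => dens i _ (or_introl erefl))
  (fun i => dens i _ (or_intror erefl)) t2.
have -> : 2 * (t / 2) = t by field.
by have -> : 256 * 200 * K / (t / 2) = 256 * 400 * K / t by field; rewrite gt_eqF.
Qed.
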